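(* Let $d \in \{1,2,3,4\}$, let $n\in\mathbb{N}$ with $n\ge 1$, let $\ell_i \le u_i$ ($i=1,\ldots,d$) be real numbers, and let $X := \{x\in\mathbb{R}^d : \ell_i \le x_i\le u_i,\ i=1,\ldots,d\}$. Let $\Sigma\in\mathbb{R}^{d\times d}$ be a symmetric positive definite matrix, and let $F(x,\xi) = \frac12\|x\|^2 - \xi^Tx$. Consider the statistical decision problem in which the state of nature is $\mu\in\mathbb{R}^d$, the data are $n$ i.i.d. samples $\xi^1,\ldots,\xi^n\sim N(\mu,\Sigma)$, the action set is $X$, and the loss is $$\mathcal{L}(\mu,x) = \Big(\tfrac12\|x\|^2-\mu^Tx\Big) - \min_{z\in X}\Big(\tfrac12\|z\|^2-\mu^Tz\Big).$$ Let $\delta^n_{SA}$ be the sample average decision rule given by $$\delta^n_{SA}(\xi^1,\ldots,\xi^n)\in\arg\min\left\{\tfrac12\|x\|^2-\overline{\xi}^Tx : x\in X\right\},\qquad \overline{\xi}:=\frac1n\sum_{i=1}^n\xi^i.$$ Then $\delta^n_{SA}$ is admissible within $\Delta^n$.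
   Context: $\|\cdot\|$ is the Euclidean norm. Underlying stochastic optimization problem: $\min_{x\in X}\{f_\mu(x) := \mathbb{E}_{\xi\sim N(\mu,\Sigma)}[F(x,\xi)]\}$, where $N(\mu,\Sigma)$ is the Gaussian distribution on $\mathbb{R}^d$ with mean $\mu$ and covariance $\Sigma$. The matrix $\Sigma$ is fixed and the states of nature are parametrized by $\mu\in\mathbb{R}^d$. The loss of an action $x\in X$ in state $\mu$ is $\mathcal{L}(\mu,x) := f_\mu(x) - \min_{z\in X} f_\mu(z)$, which for $F(x,\xi)=\frac12\|x\|^2-\xi^Tx$ is the expression in the claim. A decision rule is a (measurable) map $\delta : (\mathbb{R}^d)^n \to X$. $\Delta^n$ denotes the set of all decision rules $\delta:(\mathbb{R}^d)^n\to X$ such that the expectation $\mathbb{E}_{\xi^1,\ldots,\xi^n}[\delta(\xi^1,\ldots,\xi^n)]$ exists, where $\xi^1,\dots,\xi^n$ are i.i.d. $N(\mu,\Sigma)$. The risk of $\delta$ is $\mathcal{R}(\mu,\delta) := \mathbb{E}_{\xi^1,\ldots,\xi^n\ \text{i.i.d.}\ \sim N(\mu,\Sigma)}[\mathcal{L}(\mu,\delta(\xi^1,\ldots,\xi^n))]$. A decision rule $\delta'$ dominates $\delta$ if $\mathcal{R}(\mu,\delta')\le\mathcal{R}(\mu,\delta)$ for all $\mu\in\mathbb{R}^d$ and $\mathcal{R}(\hat\mu,\delta')<\mathcal{R}(\hat\mu,\delta)$ for some $\hat\mu\in\mathbb{R}^d$. A rule $\delta$ is admissible within $\Delta^n$ if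 no $\delta'\in\Delta^n$ dominates $\delta$. *)

(* Defs.v *)
From HB Require Import structures.
From mathcomp Require Import all_boot all_order all_algebra.
From mathcomp Require Import all_classical all_reals all_analysis.
From mathcomp Require Import measurable_realfun ring.

Set Implicit Arguments.
Unset Strict Implicit.
Unset Printing Implicit Defensive.

Import Order.TTheory GRing.Theory Num.Theory.
Import numFieldNormedType.Exports.

Local Open Scope classical_set_scope.
Local Open Scope ring_scope.

Definition cons_pair (T : Type) (n : nat) (p : T * n.-tuple T) : n.+1.-tuple T :=
  [tuple of p.1 :: p.2].

Lemma measurable_cons_pair d (T : measurableType d) n :
  measurable_fun [set: T * n.-tuple T] (@cons_pair T n).
Proof. exact: measurable_cons. Qed.

(* [power_measure m n] is the n-fold product measure m \x ... \x m. *)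
Section power_measure.
Context d (T : measurableType d) (R : realType).
Local Open Scope ereal_scope.


Section cons_measure.
Variables (m : {sigma_finite_measure set T -> \bar R}) (n : nat)
  (p : {sigma_finite_measure set (n.-tuple T) -> \bar R}).

Definition cons_measure : set (n.+1.-tuple T) -> \bar R :=
  pushforward (m \x p) (@cons_pair T n).

Let mc : measurable_fun setT (@cons_pair T n).
Proof. exact: measurable_cons_pair. Qed.

Let cons_measure0 : cons_measure set0 = 0.
Proof. by rewrite /cons_measure /pushforward preimage_set0 measure0. Qed.

Let cons_measure_ge0 A : 0 <= cons_measure A.
Proof. exact: measure_ge0. Qed.

Let cons_measure_sigma_additive : semi_sigma_additive cons_measure.
Proof. exact: measure_semi_sigma_additive. Qed.

HB.instance Definition _ := isMeasure.Build _ _ _ cons_measure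
  cons_measure0 cons_measure_ge0 cons_measure_sigma_additive.

Let cons_measure_sigma_finite : sigma_finite setT cons_measure.
Proof.
have /sigma_finiteP[F [TF ndF Foo]] := sigma_finiteT m.
have /sigma_finiteP[G [TG ndG Goo]] := sigma_finiteT p.
pose g (t : n.+1.-tuple T) := (thead t, [tuple of behead t]).
have Kg : cancel (@cons_pair T n) g.
  by case=> x t; rewrite /g theadE; congr pair; apply: val_inj.
have mg : measurable_fun setT g.
  apply/measurable_fun_pair => /=; last exact: measurable_behead.
  exact: measurable_tnth.
exists (fun k => g @^-1` (F k `*` G k)).
  rewrite -preimage_bigcup; apply/seteqP; split => // t _ /=.
  have [i _ Fi] : (\bigcup_k F k) (thead t) by rewrite -TF.
  have [j _ Gj] : (\bigcup_k G k) [tuple of behead t] by rewrite -TG.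
  exists (maxn i j) => //; split => /=.
    by move: Fi; exact/subsetPset/ndF/leq_maxl.
  by move: Gj; exact/subsetPset/ndG/leq_maxr.
move=> k; have [mF Fk] := Foo k; have [mG Gk] := Goo k; split.
  by rewrite -[X in measurable X]setTI; apply: mg => //; exact: measurableX.
rewrite /cons_measure /pushforward -comp_preimage.
rewrite (_ : g \o _ = id); last by apply/funext => x /=; rewrite Kg.
by rewrite preimage_id product_measure1E// lte_mul_pinfty// ge0_fin_numE.
Qed.

HB.instance Definition _ := Measure_isSigmaFinite.Build _ _ _ cons_measure
  cons_measure_sigma_finite.

End cons_measure.

Fixpoint power_measure_rec (m : {sigma_finite_measure set T -> \bar R}) (n : nat) :
    {sigma_finite_measure set (n.-tuple T) -> \bar R} :=
  if n is n'.+1 then cons_measure m (power_measure_rec m n') else \d_[tuple].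

Definition power_measure (m : {sigma_finite_measure set T -> \bar R}) (n : nat) :
  set (n.-tuple T) -> \bar R := power_measure_rec m n.

Arguments power_measure m n : clear implicits.
HB.instance Definition _ (m : {sigma_finite_measure set T -> \bar R}) (n : nat) :=
  SigmaFiniteMeasure.on (power_measure m n).

Section power_probability.
Variables (P : probability T R) (n : nat).

Let power_measure_setT : power_measure P n [set: n.-tuple T] = 1.
Proof.
rewrite /power_measure; elim: n => [|k IHk] /=; first by rewrite diracT.
rewrite /cons_measure /pushforward preimage_setT -setXTT product_measure1E//.
by rewrite IHk mule1; exact: (probability_setT P).
Qed.

HB.instance Definition _ := Measure_isProbability.Build _ _ _
  (power_measure P n) power_measure_setT.

End power_probability.
End power_measure.
Arguments power_measure {d T R} m n _.
Arguments power_measure_rec {d T R} m n.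

(* R^d, as column vectors, carries the Borel sigma-algebra generated by the
   coordinates. *)
Section measurable_colvec.
Context (R : realType) (d : nat).

Let coord (i : 'I_d) (x : 'cV[R]_d) : R := x i ord0.

Let measurable0 : g_sigma_preimage coord set0.
Proof. exact: sigma_algebra0. Qed.

Let measurableC A : g_sigma_preimage coord A -> g_sigma_preimage coord (~` A).
Proof. exact: sigma_algebraC. Qed.

Let measurable_bigcup (F : (set 'cV[R]_d)^nat) :
  (forall i, g_sigma_preimage coord (F i)) ->
  g_sigma_preimage coord (\bigcup_i F i).
Proof. exact: sigma_algebra_bigcup. Qed.

HB.instance Definition _ := @isMeasurable.Build default_measure_display
  'cV[R]_d (g_sigma_preimage coord) measurable0 measurableC measurable_bigcup.

Lemma measurable_coord (i : 'I_d) :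
  measurable_fun [set: 'cV[R]_d] (fun x => x i ord0).
Proof.
move=> _ Y mY; rewrite setTI; apply: sub_sigma_algebra => /=.
rewrite -bigcup_seq/=; exists i => /=; first by rewrite mem_index_enum.
by exists Y => //; rewrite setTI.
Qed.

Definition col_of_tuple (t : d.-tuple R) : 'cV[R]_d := \col_i tnth t i.

Lemma measurable_col_of_tuple : measurable_fun [set: d.-tuple R] col_of_tuple.
Proof.
move=> _ A; rewrite setTI.
suff: measurable `<=` image_set_system setT col_of_tuple measurable.
  by move=> /[apply]; rewrite /image_set_system /= setTI.
apply: smallest_sub.
  exact/sigma_algebra_image/sigma_algebra_measurable.
rewrite -bigcup_seq; apply: bigcup_sub => i _ _ [B mB <-].
rewrite /image_set_system /= !setTI -comp_preimage.
rewrite (_ : _ \o _ = (@tnth _ R)^~ i); last first.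
  by apply/funext => t /=; rewrite /coord mxE.
by rewrite -[X in measurable X]setTI; exact: measurable_tnth.
Qed.

Definition lebesgue_colvec : set 'cV[R]_d -> \bar R :=
  pushforward (power_measure lebesgue_measure d) col_of_tuple.

Let mcol := measurable_col_of_tuple.

Let lebesgue_colvec0 : lebesgue_colvec set0 = 0%E.
Proof. by rewrite /lebesgue_colvec /pushforward preimage_set0 measure0. Qed.

Let lebesgue_colvec_ge0 A : (0 <= lebesgue_colvec A)%E.
Proof. exact: measure_ge0. Qed.

Let lebesgue_colvec_sigma_additive : semi_sigma_additive lebesgue_colvec.
Proof. exact: measure_semi_sigma_additive. Qed.

HB.instance Definition _ := isMeasure.Build _ _ _ lebesgue_colvec
  lebesgue_colvec0 lebesgue_colvec_ge0 lebesgue_colvec_sigma_additive.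

End measurable_colvec.
Arguments lebesgue_colvec : clear implicits.

Section quadratic_form.
Context (R : realType).

Definition qform d (A : 'M[R]_d) (x : 'cV[R]_d) : R := (x^T *m A *m x) ord0 ord0.

Definition symposdef d (A : 'M[R]_d) : Prop :=
  A^T = A /\ forall x : 'cV[R]_d, x != 0 -> 0 < qform A x.

Lemma measurable_qform d (A : 'M[R]_d) (m : 'cV[R]_d) :
  measurable_fun [set: 'cV[R]_d] (fun x => qform A (x - m)).
Proof.
rewrite (_ : (fun _ => _) = fun x : 'cV[R]_d => \sum_j
    (\sum_i (x i ord0 - m i ord0) * A i j) * (x j ord0 - m j ord0)); last first.
  apply/funext => x; rewrite /qform mxE; apply: eq_bigr => j _.
  by rewrite !mxE; congr (_ * _); apply: eq_bigr => i _; rewrite !mxE.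
apply: measurable_sum => j; apply: measurable_funM; last first.
  by apply: measurable_funB => //; exact: measurable_coord.
apply: measurable_sum => i; apply: measurable_funM => //.
by apply: measurable_funB => //; exact: measurable_coord.
Qed.

(* completing the square in the first coordinate *)
Section schur.
Context (n : nat) (s : R) (b : 'cV[R]_n) (C : 'M[R]_n).
Hypothesis s0 : s != 0.

Let Q : 'M[R]_(1 + n) := block_mx s%:M b^T b C.
Let S : 'M[R]_n := C - s^-1 *: (b *m b^T).

Lemma qform_schur (u : R) (w : 'cV[R]_n) :
  qform Q (col_mx u%:M w) =
  s * (u + s^-1 * (b^T *m w) ord0 ord0) ^+ 2 + qform S w.
Proof.
rewrite /qform tr_col_mx mul_row_block mul_row_col tr_scalar_mx.
set B := b^T *m w; set c := w^T *m C *m w.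
have wb : w^T *m b = B.
  by rewrite -[LHS]trmxK trmx_mul trmxK -/B [B]mx11_scalar tr_scalar_mx.
rewrite !mulmxDl mulmxBr mulmxBl -/c -scalemxAr -scalemxAl mulmxA wb.
rewrite -!(mulmxA _ b^T w) -/B [B]mx11_scalar [c]mx11_scalar.
set e := B _ _; set k := c _ _.
rewrite -!scalar_mxM scale_scalar_mx !mxE !eqxx !mulr1n.
by field.
Qed.

Lemma det_schur : \det Q = s * \det S.
Proof.
have -> : Q = block_mx 1%:M 0 (s^-1 *: b) 1%:M *m block_mx s%:M b^T 0 S.
  rewrite mulmx_block !mul1mx !mul0mx ?mulmx0 !addr0 ?mul_mx_scalar ?mulmx1.
  by rewrite scalerA divff// scale1r -scalemxAl addrC subrK.
by rewrite det_mulmx det_lblock det_ublock !det1 !mul1r det_scalar1.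
Qed.

End schur.

Lemma symposdef_schur n (Q : 'M[R]_(1 + n)) : symposdef Q ->
  exists s b C, [/\ 0 < s, Q = block_mx s%:M b^T b C &
    symposdef (C - s^-1 *: (b *m b^T))].
Proof.
move=> [Qt Q0]; pose s := ulsubmx Q ord0 ord0.
have QE : Q = block_mx s%:M (dlsubmx Q)^T (dlsubmx Q) (drsubmx Q).
  rewrite -[LHS]submxK /s -mx11_scalar; congr block_mx.
  by rewrite trmx_dlsub Qt.
have s0 : 0 < s.
  have := Q0 (col_mx 1%:M 0); rewrite QE /qform tr_col_mx mul_row_block.
  rewrite mul_row_col tr_scalar_mx trmx0 !mul0mx !mulmx0 !addr0 mulmx1 mul1mx.
  rewrite mxE eqxx mulr1n; apply; rewrite col_mx_eq0 negb_and.
  by rewrite -scalemx1 scale1r oner_neq0.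
exists s, (dlsubmx Q), (drsubmx Q); split => //; split.
  rewrite linearB linearZ /= trmx_mul trmxK.
  by congr (_ - _); rewrite trmx_drsub Qt.
move=> w w0.
have := Q0 (col_mx (- s^-1 * ((dlsubmx Q)^T *m w) ord0 ord0)%:M w).
rewrite [X in qform X _]QE qform_schur ?gt_eqF// mulNr addNr expr0n mulr0 add0r; apply.
by rewrite col_mx_eq0 negb_and w0 orbT.
Qed.

Lemma symposdef_det_gt0 n (Q : 'M[R]_n) : symposdef Q -> 0 < \det Q.
Proof.
elim: n Q => [|n IHn] Q; first by rewrite det_mx00.
move=> /symposdef_schur[s [b [C [s0 -> /IHn]]]] S0.
by rewrite det_schur ?gt_eqF// mulr_gt0.
Qed.

Lemma symposdef_unit n (Q : 'M[R]_n) : symposdef Q -> Q \in unitmx.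
Proof. by move=> /symposdef_det_gt0 Q0; rewrite unitmxE unitfE gt_eqF. Qed.

Lemma symposdef_inv n (Q : 'M[R]_n) : symposdef Q -> symposdef (invmx Q).
Proof.
move=> Qspd; have Qu := symposdef_unit Qspd; have [Qt Q0] := Qspd.
split; first by rewrite trmx_inv Qt.
move=> x x0; have := Q0 (invmx Q *m x); rewrite /qform trmx_mul trmx_inv Qt.
rewrite mulmxKV// mulmxA; apply.
by apply: contra_neq x0 => /(congr1 (mulmx Q)); rewrite mulKVmx// mulmx0.
Qed.

End quadratic_form.

Section gaussian_integral.
Context (R : realType).
Local Open Scope ereal_scope.
Notation leb := (@lebesgue_measure R).

Lemma integral_exp_square (s c : R) : (0 < s)%R ->
  \int[leb]_x (expR (- 2^-1 * (s * (x - c) ^+ 2)))%:E =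
  (Num.sqrt (2 * pi / s))%:E.
Proof.
move=> s0; pose sg : R := (Num.sqrt s)^-1%R.
have sg0 : sg != 0%R by rewrite invr_eq0 gt_eqF// sqrtr_gt0.
have sg2 : (sg ^+ 2 = s^-1)%R by rewrite exprVn sqr_sqrtr// ltW.
have pk : ((normal_peak sg)^-1 = Num.sqrt (2 * pi / s))%R.
  by rewrite /normal_peak invrK sg2 -mulr_natl; congr Num.sqrt; ring.
under eq_integral => x _.
  rewrite (_ : expR _ = (normal_peak sg)^-1 * normal_pdf c sg x)%R; last first.
    rewrite normal_pdfE// mulKf ?gt_eqF ?normal_peak_gt0//.
    by rewrite /normal_fun sg2; congr expR; field; rewrite gt_eqF.
  rewrite EFinM; over.
rewrite ge0_integralZl//.
- by rewrite integral_normal_pdf mule1 pk.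
- by apply/measurable_EFinP; exact: measurable_normal_pdf.
- by move=> x _; rewrite lee_fin normal_pdf_ge0.
- by rewrite lee_fin invr_ge0 normal_peak_ge0.
Qed.

Lemma integral_exp_qform n (Q : 'M[R]_n) (m : 'cV[R]_n) : symposdef Q ->
  \int[lebesgue_colvec R n]_x (expR (- 2^-1 * qform Q (x - m)))%:E =
  (Num.sqrt ((2 * pi) ^+ n / \det Q))%:E.
Proof.
have mexp k (A : 'M[R]_k) c : measurable_fun [set: 'cV[R]_k]
    (fun x => (expR (- 2^-1 * qform A (x - c)))%:E).
  apply/measurable_EFinP/measurableT_comp => //.
  by apply: measurable_funM => //; exact: measurable_qform.
have mexpt k (A : 'M[R]_k) c : measurable_fun [set: k.-tuple R]
    (fun t => (expR (- 2^-1 * qform A (col_of_tuple t - c)))%:E).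
  exact: (measurableT_comp (mexp k A c) (@measurable_col_of_tuple R k)).
have colE k (A : 'M[R]_k) c :
    \int[lebesgue_colvec R k]_x (expR (- 2^-1 * qform A (x - c)))%:E =
    \int[power_measure leb k]_t (expR (- 2^-1 * qform A (col_of_tuple t - c)))%:E.
  by rewrite ge0_integral_pushforward//=; [exact: measurable_col_of_tuple|exact: mexp].
elim: n Q m => [|n IHn] Q m.
  move=> _; rewrite colE det_mx00 expr0 divr1 sqrtr1.
  rewrite integral_dirac//; last exact: mexpt.
  by rewrite diracT mul1e /qform [X in _ *m X]flatmx0 mulmx0 mxE mulr0 expR0.
move=> /symposdef_schur[s [b [C [s0 -> S0]]]].
pose m0 := m ord0 ord0; pose m' : 'cV[R]_n := dsubmx (m : 'cV_(1 + n)).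
pose S := (C - s^-1 *: (b *m b^T))%R.
pose beta (t : n.-tuple R) := (s^-1 * (b^T *m (col_of_tuple t - m')) ord0 ord0)%R.
rewrite colE /= /power_measure /=.
rewrite ge0_integral_pushforward//=; last 2 first.
- exact: measurable_cons_pair.
- exact: mexpt.
rewrite preimage_setT /=.
have fE x (t : n.-tuple R) :
    (- 2^-1 * qform (block_mx s%:M b^T b C)
       (col_of_tuple (cons_pair (x, t)) - m) =
     - 2^-1 * (s * (x - (m0 - beta t)) ^+ 2) +
     - 2^-1 * qform S (col_of_tuple t - m'))%R.
  rewrite (_ : _ - m = col_mx (x - m0)%:M (col_of_tuple t - m'))%R; last first.
    apply/colP => i; case: (@split_ordP 1 n i) => j ->.
      rewrite (@col_mxEu _ 1 n 1) !mxE (ord1 j) eqxx mulr1n; congr (_ - m _ _)%R.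
      exact: val_inj.
    rewrite (@col_mxEd _ 1 n 1) !mxE; congr (_ - m _ _)%R.
    by rewrite (_ : rshift 1 j = lift ord0 j) ?tnthS//; exact: val_inj.
  by rewrite qform_schur ?gt_eqF// -mulrDr /beta; congr (_ * (_ * _ ^+ 2 + _))%R; ring.
rewrite (fubini_tonelli2 (m1 := leb) (m2 := power_measure leb n)
  (fun z => (expR (- 2^-1 * qform (block_mx s%:M b^T b C)
       (col_of_tuple (cons_pair z) - m)))%:E))//=; last first.
  exact: (measurableT_comp (mexpt _ _ m) (@measurable_cons_pair _ R n)).
rewrite /fubini_G /=.
under eq_integral => t _.
  under eq_integral => x _ do rewrite fE expRD EFinM.
  rewrite ge0_integralZr//; last first.
    apply/measurable_EFinP/measurableT_comp => //.
    apply: measurable_funM => //; apply: measurable_funM => //.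
    by apply: measurable_funX; exact: measurable_funB.
  rewrite integral_exp_square//; over.
rewrite ge0_integralZl//; last first.
  exact: mexpt.
rewrite -colE IHn// -EFinM -sqrtrM; last by rewrite divr_ge0 ?mulr_ge0 ?pi_ge0 ?ltW.
rewrite det_schur ?gt_eqF// exprS; congr (Num.sqrt _)%:E.
by rewrite -/S; field; rewrite !gt_eqF// symposdef_det_gt0.
Qed.

End gaussian_integral.

(* The proof of positive definiteness is an argument of [gaussian_prob] so that
   the latter is a probability measure. *)
Section gaussian.
Context (R : realType) (d : nat).
Implicit Types (mu x : 'cV[R]_d) (Sigma : 'M[R]_d).

Definition gaussian_pdf mu Sigma x : R :=
  (Num.sqrt ((2 * pi) ^+ d * \det Sigma))^-1 *
  expR (- 2^-1 * qform (invmx Sigma) (x - mu)).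

Lemma gaussian_pdf_ge0 mu Sigma x : 0 <= gaussian_pdf mu Sigma x.
Proof. by rewrite mulr_ge0// ?invr_ge0// expR_ge0. Qed.

Lemma measurable_gaussian_pdf mu Sigma :
  measurable_fun [set: 'cV[R]_d] (gaussian_pdf mu Sigma).
Proof.
apply: measurable_funM => //; apply: measurableT_comp => //.
by apply: measurable_funM => //; exact: measurable_qform.
Qed.

Lemma integral_gaussian_pdf mu Sigma : symposdef Sigma ->
  (\int[lebesgue_colvec R d]_x (gaussian_pdf mu Sigma x)%:E = 1)%E.
Proof.
move=> Sspd; under eq_integral do rewrite EFinM.
have D0 := symposdef_det_gt0 Sspd.
rewrite ge0_integralZl//; last first.
  apply/measurable_EFinP/measurableT_comp => //.
  by apply: measurable_funM => //; exact: measurable_qform.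
rewrite integral_exp_qform; last exact: symposdef_inv.
rewrite det_inv invrK -EFinM mulVf// gt_eqF// sqrtr_gt0 mulr_gt0//.
by rewrite exprn_gt0// mulr_gt0// pi_gt0.
Qed.

Definition gaussian_prob mu Sigma (Sigma_spd : symposdef Sigma) :
    set 'cV[R]_d -> \bar R :=
  fun A => (\int[lebesgue_colvec R d]_(x in A) (gaussian_pdf mu Sigma x)%:E)%E.

Section probability.
Variables (mu : 'cV[R]_d) (Sigma : 'M[R]_d) (Sigma_spd : symposdef Sigma).
Local Notation P := (gaussian_prob mu Sigma_spd).

Let gaussian0 : P set0 = 0%E.
Proof. by rewrite /gaussian_prob integral_set0. Qed.

Let gaussian_ge0 A : (0 <= P A)%E.
Proof. by apply: integral_ge0 => x _; rewrite lee_fin gaussian_pdf_ge0. Qed.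

Let gaussian_sigma_additive : semi_sigma_additive P.
Proof.
move=> F mF tF mUF; rewrite /gaussian_prob ge0_integral_bigcup//=.
- apply: is_cvg_ereal_nneg_natsum_cond => n _ _.
  by apply: integral_ge0 => x _; rewrite lee_fin gaussian_pdf_ge0.
- apply/measurable_funTS/measurable_EFinP; exact: measurable_gaussian_pdf.
- by move=> x _; rewrite lee_fin gaussian_pdf_ge0.
Qed.

HB.instance Definition _ := isMeasure.Build _ _ _ P
  gaussian0 gaussian_ge0 gaussian_sigma_additive.

Let gaussian_setT : P [set: _] = 1%E.
Proof. exact: integral_gaussian_pdf. Qed.

HB.instance Definition _ := Measure_isProbability.Build _ _ _ P gaussian_setT.

End probability.
End gaussian.

Section decision_problem.
Context (R : realType) (d : nat).
Implicit Types (mu x : 'cV[R]_d) (X : set 'cV[R]_d).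

Definition dot (x y : 'cV[R]_d) : R := \sum_i x i ord0 * y i ord0.

(* The norm of the library on matrices is the sup norm. *)
Definition eucl_norm x : R := Num.sqrt (dot x x).

Definition box (l u : 'I_d -> R) : set 'cV[R]_d :=
  [set x | forall i, l i <= x i ord0 <= u i].

Definition F (x xi : 'cV[R]_d) : R := 2^-1 * eucl_norm x ^+ 2 - dot xi x.

Definition argmin X (f : 'cV[R]_d -> R) : set 'cV[R]_d :=
  [set x | X x /\ forall z, X z -> f x <= f z].

(* On a nonempty compact [X], such as a box, the infimum is attained. *)
Definition loss X mu x : R := F x mu - inf [set F z mu | z in X].

Variables (n : nat) (X : set 'cV[R]_d) (Sigma : 'M[R]_d).
Hypothesis Sigma_spd : symposdef Sigma.

Definition sample_law mu : probability (n.-tuple 'cV[R]_d) R :=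
  power_measure (gaussian_prob mu Sigma_spd) n.

(* The expectation of a vector exists when its coordinates are integrable. *)
Definition decision_rule (delta : n.-tuple 'cV[R]_d -> 'cV[R]_d) : Prop :=
  [/\ measurable_fun setT delta,
      forall xi, X (delta xi) &
      forall mu (i : 'I_d),
        (sample_law mu).-integrable setT (fun xi => (delta xi i ord0)%:E)].

Definition risk mu (delta : n.-tuple 'cV[R]_d -> 'cV[R]_d) : \bar R :=
  'E_(sample_law mu)[fun xi => loss X mu (delta xi)].

Definition dominates (delta' delta : n.-tuple 'cV[R]_d -> 'cV[R]_d) : Prop :=
  (forall mu, risk mu delta' <= risk mu delta)%E /\
  (exists mu, risk mu delta' < risk mu delta)%E.

Definition admissible (delta : n.-tuple 'cV[R]_d -> 'cV[R]_d) : Prop :=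
  ~ exists2 delta', decision_rule delta' & dominates delta' delta.

Definition sample_mean (xi : n.-tuple 'cV[R]_d) : 'cV[R]_d :=
  n%:R^-1 *: \sum_(i < n) tnth xi i.

End decision_problem.

(* Main.v *)
Require Import Defs.
From mathcomp Require Import all_boot all_order all_algebra.
From mathcomp Require Import all_classical all_reals all_analysis.
From mathcomp Require Import measurable_realfun ring lra.

Set Implicit Arguments.
Unset Strict Implicit.
Unset Printing Implicit Defensive.

Import Order.TTheory GRing.Theory Num.Theory.
Import numFieldNormedType.Exports.

Local Open Scope classical_set_scope.
Local Open Scope ring_scope.

(** The loss is, up to a factor and a term depending on [mu] only, the squared
    distance [sqdist x mu], and the sample average rule clips each coordinate of
    the sample mean to the box.  Admissibility follows by Blyth's method with
    conjugate Gaussian priors.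

    Suppose that [delta'] is nowhere worse than the sample average rule [delta].
    Draw the state as [mu = k *: z] with [z] distributed according to
    [N(0, Sigma)], and put [b = 1 + n k^2].  Relative to the sample law in state
    [0], the sample law in state [mu] has the density [likelihood], which depends
    on the data through the sample mean only ([integral_likelihood]).  Completing
    the square ([integral_posterior]) shows that the posterior is Gaussian, that
    its mean is the sample mean shrunk by [1 - 1/b], and that the data have a
    density [marginal], at least [b ^ (- d / 2)], with respect to state [0].

    Given the data, the best action clips the posterior mean.  Clipping the
    sample mean instead loses at most of order [b^-2] per coordinate, and loses
    nothing when that coordinate of the sample mean exceeds a fixed bound [M] in
    absolute value, since then both clips give the same endpoint
    ([clip_shrink]).  Strong convexity adds a multiple of [sqdist delta' delta]
    to the Bayes risk of [delta'].  With [D] the expectation of that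
    distance in state [0], comparing Bayes risks gives
      [b ^ (- d / 2) * D <= const * b^-2 * p],
    where [p] is the sum over the coordinates of the probabilities, under the
    prior, that this coordinate of the sample mean lies between [- M] and [M].
    For [d <= 4] this implies [D <= const * p], and [p] tends to [0] as [k] grows
    ([marginal_strip_cvg0]).  Hence [D = 0]: the two rules agree almost surely, in
    state [0] and therefore in every state, and [delta'] is nowhere better. *)

(** * Measures with a density *)

Section density.
Context d (T : measurableType d) (R : realType).
Variables (mu nu : {measure set T -> \bar R}) (g : T -> R).
Hypotheses (g_ge0 : forall x, 0 <= g x) (mg : measurable_fun setT g).
Hypothesis nuE : forall A, measurable A -> nu A = (\int[mu]_(x in A) (g x)%:E)%E.
Local Open Scope ereal_scope.

Import HBNNSimple.

Let mgE : measurable_fun setT (EFin \o g).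
Proof. exact/measurable_EFinP. Qed.

Let integral_density_nnsfun (f : {nnsfun T >-> R}) :
  \int[nu]_x (f x)%:E = \int[mu]_x ((f x)%:E * (g x)%:E).
Proof.
have mfg r : measurable_fun setT (fun x => (\1_(f @^-1` [set r]) x)%:E * (g x)%:E).
  apply: emeasurable_funM => //; exact/measurable_EFinP/measurable_indic.
under [LHS]eq_integral do rewrite fimfunE -fsumEFin//.
rewrite [LHS]ge0_integral_fsum//; last 2 first.
  - by move=> r; exact/measurable_EFinP/measurableT_comp.
  - by move=> n x _; rewrite EFinM nnfun_muleindic_ge0.
under [RHS]eq_integral => x _.
  rewrite fimfunE -fsumEFin// ge0_mule_fsuml; last first.
    by move=> r; rewrite EFinM nnfun_muleindic_ge0.
  over.
rewrite [RHS]ge0_integral_fsum//; last 2 first.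
  - move=> r; under eq_fun do rewrite EFinM -muleA.
    by apply: emeasurable_funM.
  - move=> r x _; rewrite mule_ge0 ?lee_fin// -lee_fin EFinM.
    by rewrite nnfun_muleindic_ge0.
apply: eq_fsbigr => r; rewrite inE/= => -[t _ <-].
under [RHS]eq_integral do rewrite EFinM -muleA.
rewrite integralZl_indic_nnsfun//= [in RHS]ge0_integralZl//; last 2 first.
- by move=> x _; rewrite mule_ge0// lee_fin.
- by rewrite lee_fin.
congr (_ * _); rewrite integral_indic// setIT nuE// [LHS]integral_mkcond.
apply: eq_integral => x _; rewrite patchE indicE.
by case: ifPn => _; rewrite ?mul1e ?mul0e.
Qed.

Lemma integral_density (f : T -> \bar R) :
  measurable_fun setT f -> (forall x, 0 <= f x) ->
  \int[nu]_x f x = \int[mu]_x (f x * (g x)%:E).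
Proof.
move=> mf f0; pose f_ := nnsfun_approx measurableT mf.
transitivity (limn (fun n => \int[nu]_x (f_ n x)%:E)).
  rewrite -monotone_convergence//=.
  - apply: eq_integral => x _; apply/esym/cvg_lim => //=.
    exact: cvg_nnsfun_approx.
  - by move=> n; exact/measurable_EFinP/measurable_funTS.
  - by move=> n ? _; rewrite lee_fin.
  - by move=> ? _ ? ? mn; rewrite lee_fin; exact/lefP/nd_nnsfun_approx.
under eq_fun do rewrite integral_density_nnsfun.
rewrite -monotone_convergence//=.
- apply: eq_integral => x _; apply: cvg_lim => //=.
  apply: cvgeZr => //; exact: cvg_nnsfun_approx.
- move=> n; apply: emeasurable_funM => //.
  exact/measurable_EFinP/measurable_funTS.
- by move=> n x _; rewrite mule_ge0// lee_fin.
- move=> x _ ? ? mn; apply: lee_wpmul2r; rewrite ?lee_fin//.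
  exact/lefP/nd_nnsfun_approx.
Qed.

End density.

(** * Gaussian vectors *)

Section bilinear_form.
Context (R : realType) (d : nat) (A : 'M[R]_d).
Implicit Types x y z : 'cV[R]_d.

Definition bform x y : R := (x^T *m A *m y) ord0 ord0.

Lemma bformDl x y z : bform (x + y) z = bform x z + bform y z.
Proof. by rewrite /bform linearD /= !mulmxDl mxE. Qed.

Lemma bformDr x y z : bform x (y + z) = bform x y + bform x z.
Proof. by rewrite /bform mulmxDr mxE. Qed.

Lemma bformZl a x y : bform (a *: x) y = a * bform x y.
Proof. by rewrite /bform linearZ /= -!scalemxAl mxE. Qed.

Lemma bformZr a x y : bform x (a *: y) = a * bform x y.
Proof. by rewrite /bform -scalemxAr mxE. Qed.

Lemma bform_sumr I (r : seq I) x (y : I -> 'cV[R]_d) :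
  bform x (\sum_(i <- r) y i) = \sum_(i <- r) bform x (y i).
Proof.
apply: (big_morph (bform x) (bformDr x)).
by rewrite /bform mulmx0 mxE.
Qed.

Lemma bformxx x : bform x x = qform A x. Proof. by []. Qed.

Lemma qformZ a x : qform A (a *: x) = a ^+ 2 * qform A x.
Proof. by rewrite -!bformxx bformZl bformZr mulrA expr2. Qed.

Hypothesis AT : A^T = A.

Lemma bformC x y : bform x y = bform y x.
Proof.
rewrite /bform.
transitivity ((x^T *m A *m y)^T ord0 ord0); first by rewrite [in RHS]mxE.
by rewrite !trmx_mul trmxK AT mulmxA.
Qed.

Lemma qformD x y : qform A (x + y) = qform A x + 2 * bform x y + qform A y.
Proof. rewrite -!bformxx !bformDl !bformDr (bformC y x); ring. Qed.

Lemma qformB x y : qform A (x - y) = qform A x - 2 * bform y x + qform A y.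
Proof.
rewrite -scaleN1r qformD bformZr qformZ (bformC x) sqrrN expr1n; ring.
Qed.

End bilinear_form.

Lemma qform_ge0 (R : realType) d (A : 'M[R]_d) x : symposdef A -> 0 <= qform A x.
Proof.
move=> [_ A0]; have [->|/A0/ltW//] := eqVneq x 0.
by rewrite /qform mulmx0 mxE.
Qed.

Lemma measurable_bform (R : realType) d (A : 'M[R]_d) d' (T : measurableType d')
    (f g : T -> 'cV[R]_d) :
  (forall i, measurable_fun setT (fun t => f t i ord0)) ->
  (forall i, measurable_fun setT (fun t => g t i ord0)) ->
  measurable_fun setT (fun t => bform A (f t) (g t)).
Proof.
move=> mf mg; rewrite (_ : (fun _ => _) = fun t =>
    \sum_j (\sum_i f t i ord0 * A i j) * g t j ord0); last first.
  apply/funext => t; rewrite /bform mxE; apply: eq_bigr => j _.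
  by rewrite mxE; congr (_ * _); apply: eq_bigr => i _; rewrite mxE.
apply: measurable_sum => j; apply: measurable_funM => //.
by apply: measurable_sum => i; exact: measurable_funM.
Qed.

Lemma integral_cst_probability d (T : measurableType d) (R : realType)
  (P : probability T R) (r : \bar R) : (\int[P]_x r = r)%E.
Proof.
rewrite integral_cst// -[RHS]mule1; congr (_ * _)%E; exact: (probability_setT P).
Qed.

Section gaussian_shift.
Context (R : realType) (d : nat) (S : 'M[R]_d) (S_spd : symposdef S).
Implicit Types m w x : 'cV[R]_d.
Local Notation A := (invmx S).
Local Notation N m := (gaussian_prob m S_spd).

Let AT : A^T = A. Proof. by have [] := symposdef_inv S_spd. Qed.

Lemma integral_gaussian_prob m (f : 'cV[R]_d -> \bar R) :
  measurable_fun setT f -> (forall x, 0 <= f x)%E ->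
  (\int[N m]_x f x =
   \int[lebesgue_colvec R d]_x (f x * (gaussian_pdf m S x)%:E))%E.
Proof.
move=> mf f0; apply: integral_density => //.
- exact: gaussian_pdf_ge0.
- exact: measurable_gaussian_pdf.
Qed.

Lemma gaussian_pdf_shift m w x : gaussian_pdf (m + w) S x =
  gaussian_pdf m S x * expR (bform A w (x - m) - 2^-1 * qform A w).
Proof.
rewrite /gaussian_pdf -mulrA -expRD; congr (_ * expR _).
rewrite opprD addrA (qformB AT _ w); by field.
Qed.

(** The Cameron-Martin formula: Gaussians with the same covariance are mutually
    absolutely continuous, with this log-affine density. *)
Lemma integral_gaussian_shift m w (f : 'cV[R]_d -> \bar R) :
  measurable_fun setT f -> (forall x, 0 <= f x)%E ->
  (\int[N (m + w)%R]_x f x =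
   \int[N m]_x (f x * (expR (bform A w (x - m) - 2^-1 * qform A w))%:E))%E.
Proof.
move=> mf f0; apply: (etrans (integral_gaussian_prob (m + w) mf f0)).
apply/esym; apply: (etrans (integral_gaussian_prob m _ _)).
- apply: emeasurable_funM => //; apply/measurable_EFinP.
  apply: measurableT_comp => //; apply: measurable_funB => //.
  apply: measurable_bform => // j; under eq_fun do rewrite !mxE.
  by apply: measurable_funB => //; exact: measurable_coord.
- by move=> x; rewrite mule_ge0// lee_fin expR_ge0.
- by apply: eq_integral => x _; rewrite -muleA -EFinM gaussian_pdf_shift [in RHS]mulrC.
Qed.

Lemma bform_col i x : bform A (col i S) x = x i ord0.
Proof.
have [ST _] := S_spd; rewrite /bform tr_col ST -row_mul mulmxV.
  by rewrite row1 -rowE mxE.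
exact: symposdef_unit.
Qed.

Lemma bform_coll i x : bform A x (col i S) = x i ord0.
Proof. by rewrite bformC// bform_col. Qed.

Lemma qform_col i : qform A (col i S) = S i i.
Proof. by rewrite -bformxx bform_col mxE. Qed.

(** The moment generating function is the total mass of the Gaussian shifted by
    a multiple of [col i S], for which the density involves the coordinate [i]
    only ([bform_col]). *)
Lemma gaussian_mgf m i (t : R) :
  (\int[N m]_x (expR (t * (x i ord0 - m i ord0)))%:E =
   (expR (2^-1 * (t ^+ 2 * S i i)))%:E)%E.
Proof.
have me : measurable_fun setT (fun x : 'cV[R]_d =>
    expR (t * (x i ord0 - m i ord0))).
  apply: measurableT_comp => //; apply: measurable_funM => //.
  by apply: measurable_funB => //; exact: measurable_coord.
have := etrans (esym (integral_cst_probability (N (m + t *: col i S)) 1))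
  (integral_gaussian_shift m (t *: col i S) (measurable_cst 1%E) (fun=> lee01)).
under eq_integral => x _.
  rewrite mul1e bformZl bform_col qformZ qform_col expRD EFinM mxE [(- m)%R i ord0]mxE.
  over.
rewrite ge0_integralZr//.
- move=> /(congr1 (fun y => y * (expR (2^-1 * (t ^+ 2 * S i i)))%:E)%E).
  by rewrite mul1e -muleA -EFinM -expRD addNr expR0 mule1.
- exact/measurable_EFinP.
Qed.

End gaussian_shift.

Section gaussian_moments.
Context (R : realType) (d : nat) (S : 'M[R]_d) (S_spd : symposdef S).
Variables (m : 'cV[R]_d) (i : 'I_d).
Local Notation N := (gaussian_prob m S_spd).

Let y (x : 'cV[R]_d) : R := x i ord0 - m i ord0.

Let my : measurable_fun setT y.
Proof. by apply: measurable_funB => //; exact: measurable_coord. Qed.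

Let integrable_exp t : N.-integrable setT (fun x => (expR (t * y x))%:E).
Proof.
apply/integrableP; split.
  by apply/measurable_EFinP; apply: measurableT_comp => //; exact: measurable_funM.
under eq_integral do rewrite gee0_abs ?lee_fin ?expR_ge0//.
by rewrite gaussian_mgf ltry.
Qed.

Let sqr_le_exp (t : R) : t ^+ 2 <= 2 * (expR t + expR (- t)).
Proof.
suff le_exp (s : R) : 0 <= s -> s ^+ 2 <= 2 * expR s.
  have [t0|/ltW t0] := leP 0 t.
    by have := le_exp _ t0; have := expR_ge0 (- t); lra.
  by have := le_exp (- t); rewrite oppr_ge0 sqrrN => /(_ t0); have := expR_ge0 t; lra.
by move=> s0; have := expR_ge1Dxn 1 s0; rewrite (_ : 2`! = 2)%N//; lra.
Qed.

Let integrable_sqr : N.-integrable setT (fun x => (y x ^+ 2)%:E).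
Proof.
apply: (@le_integrable _ _ _ N _ measurableT _
  (fun x => 2%:E * ((expR (1 * y x))%:E + (expR (-1 * y x))%:E))%E).
- by apply/measurable_EFinP; exact: measurable_funX.
- move=> x _; rewrite -EFinD -EFinM /= lee_fin ger0_norm ?sqr_ge0// ger0_norm.
    by rewrite mul1r mulN1r.
  by rewrite mulr_ge0// addr_ge0// expR_ge0.
- by apply: integrableZl => //; apply: integrableD.
Qed.

Let integrable_y : N.-integrable setT (fun x => (y x)%:E).
Proof.
apply: (@le_integrable _ _ _ N _ measurableT _
  (fun x => 1%:E + (y x ^+ 2)%:E)%E).
- exact/measurable_EFinP.
- move=> x _; rewrite -EFinD /= lee_fin [leRHS]ger0_norm ?addr_ge0 ?sqr_ge0//.
  rewrite -(real_normK (num_real (y x))).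
  by have := sqr_ge0 (`|y x| - 1); have := normr_ge0 (y x); nra.
- apply: integrableD => //; exact: finite_measure_integrable_cst.
Qed.

(** Integrating the bound [t y <= exp (t y) - 1] gives [t e <= exp (t^2 s / 2) - 1]
    for every real [t], where [e] is the mean of [y]; the right-hand side being
    of second order at [t = 0], the first-order coefficient [e] vanishes. *)
Let integral_y : (\int[N]_x (y x)%:E = 0)%E.
Proof.
have Ey : (\int[N]_x (y x)%:E)%E \is a fin_num by exact: integrable_fin_num.
rewrite -(fineK Ey); set e := fine _; congr EFin.
have s0 : 0 <= S i i by rewrite -(qform_col S_spd); apply/qform_ge0/symposdef_inv.
set s := S i i in s0.
have le_e t : 1 + t * e <= expR (2^-1 * (t ^+ 2 * s)).
  rewrite -lee_fin -(gaussian_mgf S_spd m i) EFinD EFinM fineK//.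
  rewrite -[X in (X + _)%E](integral_cst_probability N) -integralZl// -integralD//.
  - apply: le_integral => //.
    - apply: integrableD => //; first exact: finite_measure_integrable_cst.
      exact: integrableZl.
    - by move=> x _; rewrite lee_fin expR_ge1Dx.
  - exact: finite_measure_integrable_cst.
  - exact: integrableZl.
(* The bound is contradicted at [t = k * e], with [k] so small that [k * s < 1]
   and [k * e ^+ 2 <= 1]. *)
apply/eqP/negPn/negP => e0.
have e2 : 0 < e ^+ 2 by rewrite exprn_even_gt0.
have D0 : 0 < (1 + s) * (1 + e ^+ 2) by nra.
pose k := ((1 + s) * (1 + e ^+ 2))^-1.
have k0 : 0 < k by rewrite invr_gt0.
have kD : k * ((1 + s) * (1 + e ^+ 2)) = 1 by rewrite mulVf ?gt_eqF.
have ke1 : k * e ^+ 2 <= 1 by rewrite -kD ler_pM2l//; nra.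
have ks1 : k * s < 1 by rewrite -kD ltr_pM2l//; nra.
have ke0 : 0 < k * e ^+ 2 by rewrite mulr_gt0.
have ks0 : 0 <= k * s by rewrite mulr_ge0// ltW.
have := le_e (k * e).
rewrite (_ : k * e * e = k * e ^+ 2); last by ring.
rewrite (_ : _ * (_ * s) = 2^-1 * (k * e ^+ 2 * (k * s))); last by ring.
set a := k * e ^+ 2 in ke0 ke1 *; set c := k * s in ks0 ks1 *.
have := expR_ge1Dx (- (2^-1 * (a * c))); rewrite expRN => le_inv le_exp.
have expz0 := expR_gt0 (2^-1 * (a * c)).
have : (1 - 2^-1 * (a * c)) * (1 + a) <= 1.
  have ac0 : 0 <= 1 - 2^-1 * (a * c) by nra.
  apply: (le_trans (ler_wpM2l ac0 le_exp)).
  by rewrite -ler_pdivlMr// mul1r.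
have : 0 < a * (1 - c) by rewrite mulr_gt0// subr_gt0.
nra.
Qed.

(** The bias-variance decomposition; the variance [v] does not depend on [a],
    which will be a coordinate of the action. *)
Lemma gaussian_second_moment : exists2 v : R, 0 <= v & forall a k : R,
  (\int[N]_x ((a - k * x i ord0) ^+ 2)%:E =
   ((a - k * m i ord0) ^+ 2 + k ^+ 2 * v)%:E)%E.
Proof.
have Ey2 := integrable_fin_num measurableT integrable_sqr.
exists (fine (\int[N]_x (y x ^+ 2)%:E)%E).
  by apply/fine_ge0/integral_ge0 => x _; rewrite lee_fin sqr_ge0.
move=> a k; set c := a - k * m i ord0.
have -> : (fun x : 'cV[R]_d => ((a - k * x i ord0) ^+ 2)%:E) = (fun x =>
    (c ^+ 2)%:E + ((- 2 * c * k)%:E * (y x)%:E + (k ^+ 2)%:E * (y x ^+ 2)%:E))%E.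
  by apply/funext => x; rewrite -!EFinM -!EFinD /y /c; congr EFin; ring.
rewrite integralD//; last 2 first.
- exact: finite_measure_integrable_cst.
- by apply: integrableD => //; exact: integrableZl.
rewrite integral_cst_probability integralD//; try exact: integrableZl.
by rewrite !integralZl// integral_y mule0 add0e EFinD [in RHS](EFinM (k ^+ 2)) fineK.
Qed.

End gaussian_moments.

(** * Product measures *)

Section power_measure_density.
Context d (T : measurableType d) (R : realType).
Variables (m1 m2 : {sigma_finite_measure set T -> \bar R}) (r : T -> R).
Hypotheses (r_ge0 : forall x, 0 <= r x) (mr : measurable_fun setT r).
Hypothesis m1E : forall f : T -> \bar R, measurable_fun setT f ->
  (forall x, 0 <= f x)%E -> (\int[m1]_x f x = \int[m2]_x (f x * (r x)%:E))%E.
Local Open Scope ereal_scope.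

Let integral_powerS (m : {sigma_finite_measure set T -> \bar R}) n
    (f : n.+1.-tuple T -> \bar R) :
  measurable_fun setT f -> (forall t, 0 <= f t) ->
  \int[power_measure m n.+1]_t f t =
  \int[m]_x \int[power_measure m n]_t f (cons_pair (x, t)).
Proof.
move=> mf f0; rewrite {1}/power_measure /=.
rewrite ge0_integral_pushforward//=; last exact: measurable_cons_pair.
rewrite preimage_setT /=.
rewrite (fubini_tonelli1 (m1 := m) (m2 := power_measure m n)
  (f \o @cons_pair T n))//=.
exact: (measurableT_comp mf (@measurable_cons_pair _ T n)).
Qed.

Lemma measurable_tuple_prod n :
  measurable_fun [set: n.-tuple T] (fun t => \prod_(i < n) r (tnth t i))%R.
Proof.
apply: measurable_prod => i _; apply: measurableT_comp => //.
exact: measurable_tnth.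
Qed.

(** The density of a power of [m1] is the product of the densities of its
    factors, by induction and Tonelli. *)
Lemma integral_power_density n (f : n.-tuple T -> \bar R) :
  measurable_fun setT f -> (forall t, 0 <= f t) ->
  \int[power_measure m1 n]_t f t =
  \int[power_measure m2 n]_t (f t * (\prod_(i < n) r (tnth t i))%:E).
Proof.
elim: n f => [|n IHn] f mf f0.
  by under [RHS]eq_integral do rewrite big_ord0 mule1.
have mfr : measurable_fun setT (fun t : n.+1.-tuple T =>
    f t * (\prod_(i < n.+1) r (tnth t i))%:E).
  apply: emeasurable_funM => //; apply/measurable_EFinP.
  exact: measurable_tuple_prod.
rewrite integral_powerS// integral_powerS//; last first.
  by move=> t; rewrite mule_ge0// lee_fin prodr_ge0.
have mfc : measurable_fun setT (fun z : T * n.-tuple T => f (cons_pair z)).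
  exact: (measurableT_comp mf (@measurable_cons_pair _ T n)).
pose h (z : T * n.-tuple T) : \bar R :=
  f (cons_pair z) * (\prod_(i < n) r (tnth z.2 i))%:E.
have mh : measurable_fun setT h.
  apply: emeasurable_funM => //; apply/measurable_EFinP.
  by apply: (measurableT_comp (@measurable_tuple_prod n)).
have h0 z : 0 <= h z by rewrite mule_ge0// lee_fin prodr_ge0.
under eq_integral => x _.
  rewrite IHn//; last exact: (measurableT_comp mfc).
  over.
rewrite m1E.
- apply: eq_integral => x _.
  rewrite -ge0_integralZr//; last 3 first.
  - exact: (measurableT_comp mh (pair1_measurable x)).
  - by move=> t _; exact: (h0 (x, t)).
  - by rewrite lee_fin.
  apply: eq_integral => t _; rewrite -muleA -EFinM; congr (_ * _%:E).
  rewrite big_ord_recl mulrC; congr (_ * _)%R.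
  by apply: eq_bigr => i _; rewrite tnthS.
- exact: (measurable_fun_fubini_tonelli_F (m2 := power_measure m2 n) h mh h0).
- by move=> x; apply: integral_ge0 => t _; exact: (h0 (x, t)).
Qed.

End power_measure_density.

Lemma power_lebesgue_hyperplane (R : realType) (n : nat) (i : 'I_n) (c : R) :
  power_measure lebesgue_measure n [set t : n.-tuple R | tnth t i = c] = 0%E.
Proof.
elim: n i => [[]//|n IHn] i.
rewrite /power_measure /= /cons_measure /pushforward.
case: (unliftP ord0 i) => [j|] ->.
  rewrite (_ : _ @^-1` _ = setT `*` [set t | tnth t j = c]); last first.
    by apply/seteqP; split => -[x t] /=; rewrite tnthS// => -[].
  rewrite product_measure1E//; last first.
    rewrite (_ : [set t | _] = (fun t : n.-tuple R => tnth t j) @^-1` [set c])//.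
    rewrite -[X in measurable X]setTI; exact: measurable_tnth.
  by have := IHn j; rewrite /power_measure => ->; rewrite mule0.
rewrite (_ : _ @^-1` _ = [set c] `*` setT); last first.
  by apply/seteqP; split => -[x t] /=; rewrite ?theadE// => -[].
by rewrite product_measure1E// [X in (X * _)%E]lebesgue_measure_set1 mul0e.
Qed.

(** Needed because the bound [expR (- (k * `|z i|))] vanishes in the limit only
    where [z i <> 0]. *)
Lemma gaussian_hyperplane (R : realType) (d : nat) (S : 'M[R]_d)
    (S_spd : symposdef S) (m : 'cV[R]_d) (i : 'I_d) (c : R) :
  gaussian_prob m S_spd [set x | x i ord0 = c] = 0%E.
Proof.
have mA : measurable [set x : 'cV[R]_d | x i ord0 = c].
  rewrite (_ : [set x | _] = (fun x : 'cV[R]_d => x i ord0) @^-1` [set c])//.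
  rewrite -[X in measurable X]setTI; exact: measurable_coord.
apply: null_set_integral => //.
  apply/measurable_funTS/measurable_EFinP; exact: measurable_gaussian_pdf.
rewrite /= /lebesgue_colvec /pushforward.
rewrite (_ : _ @^-1` _ = [set t | tnth t i = c]).
  exact: power_lebesgue_hyperplane.
by apply/seteqP; split => t /=; rewrite mxE.
Qed.

(** * The likelihood and the posterior *)

Lemma symposdefZ (R : realType) d (S : 'M[R]_d) (a : R) :
  0 < a -> symposdef S -> symposdef (a *: S).
Proof.
move=> a0 [ST S0]; split; first by rewrite linearZ /= ST.
by move=> x /S0 x0; rewrite /qform -scalemxAr -scalemxAl mxE mulr_gt0.
Qed.

Lemma qformZm (R : realType) d (S : 'M[R]_d) (a : R) x :
  qform (a *: S) x = a * qform S x.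
Proof. by rewrite /qform -scalemxAr -scalemxAl mxE. Qed.

Lemma measurable_sample_mean (R : realType) d n i :
  measurable_fun [set: n.-tuple 'cV[R]_d] (fun xi => sample_mean xi i ord0).
Proof.
under eq_fun do rewrite mxE summxE.
apply: measurable_funM => //; apply: measurable_sum => j.
apply: (measurableT_comp (@measurable_coord R d i)).
exact: measurable_tnth.
Qed.

Section likelihood.
Context (R : realType) (d n : nat) (n_gt0 : (0 < n)%N).
Variables (S : 'M[R]_d) (S_spd : symposdef S).
Implicit Types (mu z : 'cV[R]_d) (xi : n.-tuple 'cV[R]_d).
Local Notation A := (invmx S).
Local Notation N mu := (gaussian_prob mu S_spd).
Local Notation P mu := (sample_law n S_spd mu).

Let AT : A^T = A. Proof. by have [] := symposdef_inv S_spd. Qed.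
Let n0 : n%:R != 0 :> R. Proof. by rewrite pnatr_eq0 -lt0n. Qed.

(** The density of the sample in state [mu] relative to the sample in
    state [0]; the sample mean is a sufficient statistic. *)
Definition likelihood mu xi : R :=
  expR (n%:R * bform A mu (sample_mean xi) - n%:R / 2 * qform A mu).

Lemma measurable_likelihood d' (T : measurableType d') (f : T -> 'cV[R]_d)
    (g : T -> n.-tuple 'cV[R]_d) :
  (forall i, measurable_fun setT (fun t => f t i ord0)) ->
  measurable_fun setT g ->
  measurable_fun setT (fun t => likelihood (f t) (g t)).
Proof.
move=> mf mg; apply: measurableT_comp => //; apply: measurable_funB.
  apply: measurable_funM => //; apply: measurable_bform => // i.
  exact: (measurableT_comp (@measurable_sample_mean R d n i) mg).
apply: measurable_funM => //.
by under eq_fun do rewrite -bformxx; exact: measurable_bform.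
Qed.

Lemma integral_likelihood mu (f : n.-tuple 'cV[R]_d -> \bar R) :
  measurable_fun setT f -> (forall xi, 0 <= f xi)%E ->
  (\int[P mu]_xi f xi = \int[P 0]_xi (f xi * (likelihood mu xi)%:E))%E.
Proof.
move=> mf f0.
pose r (x : 'cV[R]_d) := expR (bform A mu (x - 0) - 2^-1 * qform A mu).
have rE xi : \prod_(i < n) r (tnth xi i) = likelihood mu xi.
  rewrite /r -expR_sum /likelihood; congr expR.
  under eq_bigr do rewrite subr0.
  rewrite sumrB -bform_sumr sumr_const card_ord /sample_mean bformZr.
  by rewrite mulVKf// -[_ *+ n]mulr_natl mulrA.
have := @integral_power_density _ 'cV[R]_d R (N mu) (N 0) r _ _ _ n f mf f0.
under [X in (_ -> _ -> _ -> _ = X) -> _]eq_integral do rewrite rE.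
apply.
- by move=> x; exact: expR_ge0.
- apply: measurableT_comp => //; apply: measurable_funB => //.
  apply: measurable_bform => // i.
  by under eq_fun do rewrite subr0; exact: measurable_coord.
- move=> g mg g0; have := integral_gaussian_shift S_spd 0 mu mg g0.
  by rewrite add0r.
Qed.

Lemma integral_likelihood1 mu : (\int[P 0]_xi (likelihood mu xi)%:E = 1)%E.
Proof.
have := integral_likelihood mu (measurable_cst 1%E) (fun=> lee01).
rewrite integral_cst_probability => ->.
by apply: eq_integral => xi _; rewrite mul1e.
Qed.

Section posterior.
Variable k : R.
Let b : R := 1 + n%:R * k ^+ 2.

Let b1 : 1 <= b. Proof. by rewrite lerDl mulr_ge0 ?sqr_ge0. Qed.
Let b0 : 0 < b. Proof. exact: lt_le_trans b1. Qed.
Let b_neq0 : b != 0. Proof. by rewrite gt_eqF. Qed.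

(** The density of the sample relative to state [0] when the state is
    [k *: z] with [z] distributed according to [N 0]. *)
Definition marginal xi : R := (Num.sqrt (b ^+ d))^-1 *
  expR ((n%:R * k) ^+ 2 / (2 * b) * qform A (sample_mean xi)).

Lemma marginal_ge xi : (Num.sqrt (b ^+ d))^-1 <= marginal xi.
Proof.
rewrite /marginal ler_peMr// ?invr_ge0// -[leLHS]expR0 ler_expR.
rewrite mulr_ge0 ?divr_ge0 ?sqr_ge0 ?mulr_ge0// ?(ltW b0)//.
by apply/qform_ge0/symposdef_inv.
Qed.

Lemma marginal_ge0 xi : 0 <= marginal xi.
Proof. by apply: le_trans (marginal_ge xi); rewrite invr_ge0. Qed.

Lemma measurable_marginal : measurable_fun setT marginal.
Proof.
apply: measurable_funM => //; apply: measurableT_comp => //.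
apply: measurable_funM => //.
under eq_fun do rewrite -bformxx.
by apply: measurable_bform => i; exact: measurable_sample_mean.
Qed.

Let bS_spd : symposdef (b^-1 *: S).
Proof. by apply: symposdefZ => //; rewrite invr_gt0. Qed.

Let post_mean xi : 'cV[R]_d := (n%:R * k / b) *: sample_mean xi.

(** Completing the square. *)
Let pdf_likelihood z xi :
  gaussian_pdf 0 S z * likelihood (k *: z) xi =
  marginal xi * gaussian_pdf (post_mean xi) (b^-1 *: S) z.
Proof.
have D0 : 0 < \det S by exact: symposdef_det_gt0.
rewrite /gaussian_pdf; have -> : invmx (b^-1 *: S) = b *: A.
  by rewrite invmxZ ?invrK// symposdef_unit.
rewrite /likelihood /marginal /post_mean detZ subr0 exprVn.
rewrite bformZl qformZ qformZm (qformB AT) bformZl qformZ.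
have -> : (Num.sqrt ((2 * pi) ^+ d * \det S))^-1 = (Num.sqrt (b ^+ d))^-1 *
    (Num.sqrt ((2 * pi) ^+ d * ((b ^+ d)^-1 * \det S)))^-1 :> R.
  rewrite -invfM -sqrtrM ?exprn_ge0 ?(ltW b0)//; congr (Num.sqrt _)^-1.
  by rewrite mulrCA mulVKf// expf_neq0.
rewrite -[LHS]mulrA -expRD [RHS]mulrACA -expRD; congr (_ * expR _).
rewrite (bformC AT z); move: b_neq0; rewrite /b => ?; field => //.
Qed.

(** The joint law of the scaled state and the sample, disintegrated along the
    sample. *)
Lemma integral_posterior (f : 'cV[R]_d -> \bar R) xi :
  measurable_fun setT f -> (forall z, 0 <= f z)%E ->
  (\int[N 0]_z (f z * (likelihood (k *: z) xi)%:E) =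
   (marginal xi)%:E * \int[gaussian_prob (post_mean xi) bS_spd]_z f z)%E.
Proof.
move=> mf f0; have mL : measurable_fun setT (fun z => likelihood (k *: z) xi).
  apply: measurable_likelihood => // i; under eq_fun do rewrite mxE.
  by apply: measurable_funM => //; exact: measurable_coord.
apply: (etrans (integral_gaussian_prob S_spd 0 _ _)).
- by apply: emeasurable_funM => //; exact/measurable_EFinP.
- by move=> z; rewrite mule_ge0// lee_fin expR_ge0.
apply/esym; apply: (etrans (congr1 (fun y => (marginal xi)%:E * y)%E
  (integral_gaussian_prob bS_spd (post_mean xi) mf f0))).
rewrite -ge0_integralZl; first last.
- by rewrite lee_fin marginal_ge0.
- by move=> z _; rewrite mule_ge0// lee_fin gaussian_pdf_ge0.
- apply: emeasurable_funM => //; apply/measurable_EFinP.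
  exact: measurable_gaussian_pdf.
- by [].
apply: eq_integral => z _; rewrite -[RHS]muleA -EFinM [in RHS]mulrC.
by rewrite pdf_likelihood EFinM muleCA.
Qed.

Lemma integral_marginal xi :
  (\int[N 0]_z (likelihood (k *: z) xi)%:E = (marginal xi)%:E)%E.
Proof.
apply: etrans (etrans (integral_posterior xi (measurable_cst 1%E)
  (fun=> lee01)) _).
  by apply: eq_integral => z _; rewrite mul1e.
apply: etrans (congr1 _ (integral_cst_probability
  (gaussian_prob (post_mean xi) bS_spd) 1)) _.
by rewrite mule1.
Qed.

(** The posterior mean of the state is the sample mean shrunk by the factor
    [1 - b^-1], and the posterior variance [v] does not depend on the action. *)
Lemma posterior_risk xi : exists2 v : R, 0 <= v & forall x : 'cV[R]_d,
  (\int[N 0]_z ((\sum_i (x i ord0 - k * z i ord0) ^+ 2) *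
      likelihood (k *: z) xi)%:E =
   (marginal xi * (v +
      \sum_i (x i ord0 - (1 - b^-1) * sample_mean xi i ord0) ^+ 2))%:E)%E.
Proof.
pose w i := cid2 (gaussian_second_moment bS_spd (post_mean xi) i).
pose v i := s2val (w i).
have v0 i : 0 <= v i := s2valP (w i).
have vP i := s2valP' (w i).
exists (\sum_i k ^+ 2 * v i).
  by apply: sumr_ge0 => i _; rewrite mulr_ge0 ?sqr_ge0.
move=> x; have mz i : measurable_fun setT
    (fun z : 'cV[R]_d => ((x i ord0 - k * z i ord0) ^+ 2)%:E).
  apply/measurable_EFinP/measurable_funX/measurable_funB => //.
  by apply: measurable_funM => //; exact: measurable_coord.
have z0 i (z : 'cV[R]_d) : (0 <= ((x i ord0 - k * z i ord0) ^+ 2)%:E)%E.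
  by rewrite lee_fin sqr_ge0.
pose f z : \bar R := (\sum_i ((x i ord0 - k * z i ord0) ^+ 2)%:E)%E.
have mf : measurable_fun setT f by exact: emeasurable_sum.
have f0 z : (0 <= f z)%E by exact: sume_ge0.
apply: etrans (etrans (integral_posterior xi mf f0) _).
  by apply: eq_integral => z _; rewrite /f sumEFin -EFinM.
rewrite [RHS]EFinM; congr (_ * _)%E; rewrite ge0_integral_sum//.
have pmE i : k * post_mean xi i ord0 = (1 - b^-1) * sample_mean xi i ord0.
  by rewrite mxE; move: b_neq0; rewrite /b => ?; field => //.
under eq_bigr => i _ do rewrite vP pmE.
by rewrite sumEFin big_split /= [in RHS]addrC.
Qed.

End posterior.
End likelihood.

(** * Bounded sample means become improbable under diffuse priors *)

Section strip.
Context (R : realType) (d n : nat) (n_gt0 : (0 < n)%N).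
Variables (S : 'M[R]_d) (S_spd : symposdef S).
Variables (i : 'I_d) (M : R).
Implicit Types (mu z : 'cV[R]_d) (xi : n.-tuple 'cV[R]_d).
Local Notation A := (invmx S).
Local Notation N := (gaussian_prob 0 S_spd).
Local Notation P := (sample_law n S_spd 0).

Definition strip : set (n.-tuple 'cV[R]_d) :=
  [set xi | `|sample_mean xi i ord0| <= M].

Lemma measurable_strip : measurable strip.
Proof.
have mf : measurable_fun setT (fun xi => `|sample_mean xi i ord0|).
  by apply: measurableT_comp => //; exact: measurable_sample_mean.
rewrite (_ : strip = (fun xi => `|sample_mean xi i ord0|) @^-1` `]-oo, M]).
  by rewrite -[X in measurable X]setTI; exact: mf.
by apply/seteqP; split => xi; rewrite /strip /= in_itv.
Qed.

Let C := expR (M + S i i / (2 * n%:R)).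

(** A Chernoff bound: [\1_strip <= expR (M + s * y)] for the coordinate [y] of the
    sample mean and [s] equal to [1] or [-1], and the factor [expR (s * y)] turns
    the likelihood of [mu] into a multiple of the likelihood of a shifted state. *)
Let strip_prob_le mu :
  (\int[P]_xi (\1_strip xi * likelihood S mu xi)%:E <=
   (C * expR (- `|mu i ord0|))%:E)%E.
Proof.
have n0 : n%:R != 0 :> R by rewrite pnatr_eq0 -lt0n.
have AT : A^T = A by have [] := symposdef_inv S_spd.
(* The sign that pulls the coordinate [i] of the state towards [0]. *)
pose s : R := if 0 <= mu i ord0 then -1 else 1.
have s2 : s ^+ 2 = 1 by rewrite /s; case: ifP; rewrite ?sqrrN expr1n.
have smu : s * mu i ord0 = - `|mu i ord0|.
  rewrite /s; case: leP => mu0; first by rewrite mulN1r ger0_norm.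
  by rewrite mul1r ltr0_norm// opprK.
pose mu' := mu + (s / n%:R) *: col i S.
have mL : measurable_fun setT (fun xi => (likelihood S mu' xi)%:E).
  by apply/measurable_EFinP; apply: measurable_likelihood.
have le_shift xi : \1_strip xi * likelihood S mu xi <=
    C * expR (- `|mu i ord0|) * likelihood S mu' xi.
  rewrite indicE; have [|_] := boolP (xi \in strip); last first.
    by rewrite mul0r !mulr_ge0 ?expR_ge0.
  rewrite inE /strip /= => xiM; rewrite mul1r -!expRD ler_expR.
  rewrite -smu bformDl bformZl (bform_col S_spd) (qformD AT) qformZ.
  rewrite bformZr (bform_coll S_spd) (qform_col S_spd).
  set y := sample_mean xi i ord0 in xiM *; set B := bform _ _ _.
  set q := qform _ _; set m := mu i ord0.
  have -> : M + S i i / (2 * n%:R) + s * m + (n%:R * (B + s / n%:R * y) - n%:R / 2 *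
      (q + 2 * (s / n%:R * m) + (s / n%:R) ^+ 2 * S i i)) =
    n%:R * B - n%:R / 2 * q + (M + s * y) + S i i / (2 * n%:R) * (1 - s ^+ 2).
    by field.
  rewrite s2 subrr mulr0 addr0 lerDl.
  by move: xiM; rewrite ler_norml /s => /andP[]; case: ifP; lra.
apply: (@le_trans _ _ (\int[P]_xi
    ((C * expR (- `|mu i ord0|))%:E * (likelihood S mu' xi)%:E))%E).
  apply: ge0_le_integral => //.
  - by move=> xi _; rewrite lee_fin mulr_ge0// expR_ge0.
  - apply/measurable_EFinP/measurable_funM; last exact: measurable_likelihood.
    by apply: measurable_indic; exact: measurable_strip.
  - exact: measurable_funeM.
  - by move=> xi _; rewrite -EFinM lee_fin.
rewrite ge0_integralZl//.
- by rewrite integral_likelihood1// mule1.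
- by move=> xi _; rewrite lee_fin expR_ge0.
- by rewrite lee_fin mulr_ge0// expR_ge0.
Qed.

Let exp_coord (k : nat) (z : 'cV[R]_d) : R := expR (- `|k%:R * z i ord0|).

Let measurable_exp_coord k : measurable_fun setT (exp_coord k).
Proof.
apply: measurableT_comp => //; apply: measurableT_comp => //.
apply: measurableT_comp => //; apply: measurable_funM => //.
exact: measurable_coord.
Qed.

Let integral_exp_coord_cvg0 :
  (\int[N]_z (exp_coord k z)%:E)%E @[k --> \oo] --> 0%E.
Proof.
have [] := @dominated_convergence _ _ R N setT measurableT
  (fun k z => (exp_coord k z)%:E) (cst 0%E) (cst 1%E).
- by move=> k; exact/measurable_EFinP.
- exact: measurable_cst.
- exists [set z : 'cV[R]_d | z i ord0 = 0]; split.
  + rewrite (_ : [set z | _] = (fun x : 'cV[R]_d => x i ord0) @^-1` [set 0])//.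
    rewrite -[X in measurable X]setTI; exact: measurable_coord.
  + exact: gaussian_hyperplane.
  + move=> z /= h; apply: contrapT => /eqP z0; apply: h => _.
    apply: cvg_EFin; first by apply: nearW.
    rewrite [X in X @ _ --> _](_ : _ = fun k => expR (- `|z i ord0|) ^+ k).
      apply: cvg_expr; rewrite ger0_norm ?expR_ge0//.
      by rewrite -expR0 ltr_expR oppr_lt0 normr_gt0.
    apply/funext => k /=; rewrite -expRM_natl /exp_coord normrM.
    by rewrite (ger0_norm (ler0n _ _)) mulrN.
- exact: finite_measure_integrable_cst.
- apply: aeW => z k _; rewrite gee0_abs lee_fin ?expR_ge0//.
  by rewrite -expR0 ler_expR oppr_le0.
move=> _ _; rewrite integral_cst// mul0e; exact.
Qed.

(** The integral is the probability of [strip] when the state is [k *: z] with [z]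
    drawn from [N 0].  By the Chernoff bound it is at most a multiple of the
    integral of [exp_coord k], which tends to [0] by dominated convergence. *)
Lemma marginal_strip_cvg0 :
  (\int[P]_xi (\1_strip xi * marginal S k%:R xi)%:E)%E @[k --> \oo] --> 0%E.
Proof.
apply: (@squeeze_cvge _ \oo _ R (fun=> 0%E) _
    (fun k => C%:E * \int[N]_z (exp_coord k z)%:E)%E).
- apply: nearW => k; rewrite integral_ge0 /=; last first.
    by move=> xi _; rewrite lee_fin mulr_ge0// marginal_ge0.
  pose f (w : 'cV[R]_d * n.-tuple 'cV[R]_d) : \bar R :=
    (\1_strip w.2 * likelihood S (k%:R *: w.1) w.2)%:E.
  have f0 w : (0 <= f w)%E by rewrite lee_fin mulr_ge0// expR_ge0.
  have mf : measurable_fun setT f.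
    apply/measurable_EFinP; apply: measurable_funM.
      have mI : measurable_fun setT (\1_strip : _ -> R).
        by apply: measurable_indic; exact: measurable_strip.
      have := measurableT_comp mI (@measurable_snd _ _ 'cV[R]_d (n.-tuple 'cV[R]_d)).
      exact.
    apply: measurable_likelihood => // j; under eq_fun do rewrite mxE.
    apply: measurable_funM => //.
    exact: (measurableT_comp (@measurable_coord R d j)).
  have -> : (\int[P]_xi (\1_strip xi * marginal S k%:R xi)%:E =
      \int[P]_xi \int[N]_z f (z, xi))%E.
    apply: eq_integral => xi _; rewrite EFinM -(integral_marginal S_spd).
    rewrite -ge0_integralZl//.
    + apply/measurable_EFinP; apply: measurable_likelihood => // j.
      under eq_fun do rewrite mxE; apply: measurable_funM => //.
      exact: measurable_coord.
    + by move=> z _; rewrite lee_fin expR_ge0.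
  rewrite -(fubini_tonelli f mf f0) -ge0_integralZl//; last 3 first.
  + exact/measurable_EFinP.
  + by move=> z _; rewrite lee_fin expR_ge0.
  + by rewrite lee_fin expR_ge0.
  apply: ge0_le_integral => //.
  + by move=> z _; apply: integral_ge0.
  + exact: (measurable_fun_fubini_tonelli_F f mf f0).
  + by apply: measurable_funeM; exact/measurable_EFinP.
  + move=> z _; rewrite /f /= -EFinM /exp_coord.
    by have := strip_prob_le (k%:R *: z); rewrite mxE.
- exact: cvg_cst.
- rewrite -[X in _ --> X](mule0 C%:E); apply: cvgeZl => //.
Qed.

End strip.

(** * Minimization over a box *)

Definition clip (R : realDomainType) (l u y : R) : R := Num.max l (Num.min y u).

Section box_minimization.
Context (R : realType) (d : nat).
Implicit Types (mu x y : 'cV[R]_d) (l u : 'I_d -> R).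

Definition sqdist x y : R := \sum_i (x i ord0 - y i ord0) ^+ 2.

Lemma sqdist_ge0 x y : 0 <= sqdist x y.
Proof. by apply: sumr_ge0 => i _; rewrite sqr_ge0. Qed.

Lemma F_coord x y : F x y = \sum_i (2^-1 * x i ord0 ^+ 2 - y i ord0 * x i ord0).
Proof.
have xx0 : 0 <= dot x x by apply: sumr_ge0 => i _; rewrite -expr2 sqr_ge0.
rewrite /F sqr_sqrtr// /dot mulr_sumr -sumrB.
by apply: eq_bigr => i _; rewrite expr2.
Qed.

Lemma F_sqdist x mu : F x mu = 2^-1 * sqdist x mu - 2^-1 * sqdist 0 mu.
Proof.
rewrite F_coord /sqdist !big_distrr -sumrB /=; apply: eq_bigr => i _.
by rewrite mxE; field.
Qed.

(** The objective is a sum of functions of one coordinate each, so replacing a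
    single coordinate of a minimizer by its clipped target cannot help. *)
Lemma argmin_box l u x y i :
  argmin (box l u) (fun z => F z y) x -> x i ord0 = clip (l i) (u i) (y i ord0).
Proof.
move=> [xX xmin]; have /andP[lx xu] := xX i.
set c := clip _ _ _.
have /andP[lc cu] : l i <= c <= u i.
  by rewrite /c /clip le_max lexx /= ge_max ge_min lexx orbT andbT (le_trans lx).
pose z : 'cV[R]_d := \col_j (if j == i then c else x j ord0).
have zX : box l u z by move=> j; rewrite mxE; case: eqP => [->|_]; rewrite ?lc ?cu.
have := xmin z zX; rewrite !F_coord (bigD1 i)//= [leRHS](bigD1 i)//= mxE eqxx.
rewrite [X in _ <= _ + X](eq_bigr (fun j =>
    2^-1 * x j ord0 ^+ 2 - y j ord0 * x j ord0)); last first.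
  by move=> j ji; rewrite mxE (negbTE ji).
rewrite lerD2r; set s := x i ord0 in lx xu *; set t := y i ord0.
have : 0 <= (s - c) * (c - t).
  rewrite /c /clip -/t; have [ut|tu] := leP (u i) t.
    by rewrite (max_idPr (le_trans lx xu)); nra.
  by have [tl|lt] := leP t (l i); [nra|rewrite subrr mulr0].
move=> h1 h2; have : (s - c) ^+ 2 <= 0 by nra.
by rewrite le_eqVlt ltNge sqr_ge0 orbF sqrf_eq0 subr_eq0 => /eqP.
Qed.

Lemma measurable_clip d' (T : measurableType d') (a b : R) (f : T -> R) :
  measurable_fun setT f -> measurable_fun setT (fun t => clip a b (f t)).
Proof.
move=> mf; apply: measurable_maxr => //.
by apply: measurable_minr.
Qed.

Lemma loss_sqdist l u mu : (forall i, l i <= u i) ->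
  exists2 k : R, 0 <= k & forall x, box l u x ->
    0 <= loss (box l u) mu x /\ sqdist x mu = 2 * loss (box l u) mu x + k.
Proof.
move=> lu; pose I := inf [set F z mu | z in box l u].
have X0 : [set F z mu | z in box l u] !=set0.
  exists (F (\col_i l i) mu) => /=; exists (\col_i l i) => // i.
  by rewrite mxE lexx lu.
have lbF : lbound [set F z mu | z in box l u] (- (2^-1 * sqdist 0 mu)).
  move=> _ [z _ <-]; rewrite F_sqdist.
  by have := sqdist_ge0 z mu; lra.
exists (2 * I + sqdist 0 mu).
  by have := lb_le_inf X0 lbF; rewrite -/I; lra.
move=> x xX; rewrite /loss -/I; split.
  rewrite subr_ge0; apply: ge_inf; last by exists x.
  by exists (- (2^-1 * sqdist 0 mu)).
by rewrite F_sqdist; field.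
Qed.

End box_minimization.

(** If [`|y| > M], the shrunk target [(1 - a) * y] lies beyond the same endpoint
    as [y], so that [clip l u y] is still its nearest point of the interval.
    Otherwise [clip l u y] is nearest to [y] itself, and replacing [y] by the
    shrunk target costs at most [2 * a * M * `|x' - clip l u y|], which part of
    the strong convexity term absorbs. *)
Lemma clip_shrink (R : realType) (l u M a y x' : R) :
  0 < a <= 2^-1 -> l <= x' <= u -> 2 * `|l| <= M -> 2 * `|u| <= M ->
  (clip l u y - (1 - a) * y) ^+ 2 + 2^-1 * (x' - clip l u y) ^+ 2 <=
  (x' - (1 - a) * y) ^+ 2 + 2 * (a ^+ 2 * M ^+ 2) * (`|y| <= M)%R%:R.
Proof.
move=> /andP[a0 a1] /andP[lx xu] lM uM; set x := clip l u y.
have lu : l <= u by exact: le_trans xu.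
have /andP[lx0 xu0] : l <= x <= u.
  by rewrite /x /clip le_max lexx /= ge_max lu ge_min lexx orbT.
have M0 : 0 <= M by apply: le_trans uM; rewrite mulr_ge0.
have [yM|yM] := leP `|y| M.
  have var : 0 <= (x' - x) * (x - y).
    rewrite /x /clip; have [uy|yu] := leP u y.
      by rewrite (max_idPr lu); nra.
    have [yl|ly] := leP y l; first by nra.
    by rewrite subrr mulr0.
  have ayM : (a * y) ^+ 2 <= a ^+ 2 * M ^+ 2.
    by rewrite exprMn ler_wpM2l ?sqr_ge0// -(real_normK (num_real y)) ler_sqr.
  have sq : 0 <= (x' - x + 2 * (a * y)) ^+ 2 by exact: sqr_ge0.
  rewrite mulr1; nra.
rewrite mulr0 addr0.
suff var : 0 <= (x' - x) * (x - (1 - a) * y) by have := sqr_ge0 (x' - x); nra.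
have [y0|y0] := leP 0 y.
  rewrite ger0_norm// in yM.
  have uy : u <= (1 - a) * y by have := ler_norm u; nra.
  have -> : x = u.
    by rewrite /x /clip min_r ?max_r//; have := ler_norm u; have := normr_ge0 u; lra.
  by nra.
rewrite ltr0_norm// in yM.
have ly : (1 - a) * y <= l by have := lerNnormlW (lexx `|l|); nra.
have -> : x = l.
  rewrite /x /clip max_l// ge_min; apply/orP; left.
  by have := lerNnormlW (lexx `|l|); have := normr_ge0 l; lra.
by nra.
Qed.

(** * Comparison of Bayes risks *)

Section bayes_comparison.
Context (R : realType) (d n : nat) (n_gt0 : (0 < n)%N).
Variables (S : 'M[R]_d) (S_spd : symposdef S) (l u : 'I_d -> R).
Implicit Types (mu z : 'cV[R]_d) (xi : n.-tuple 'cV[R]_d).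
Implicit Types delta : n.-tuple 'cV[R]_d -> 'cV[R]_d.
Local Notation N := (gaussian_prob 0 S_spd).
Local Notation P mu := (sample_law n S_spd mu).

Definition coord_measurable delta :=
  forall i, measurable_fun setT (fun xi => delta xi i ord0).

Definition sqrisk mu delta : \bar R := (\int[P mu]_xi (sqdist (delta xi) mu)%:E)%E.

Lemma measurable_sqdist d' (T : measurableType d') (f g : T -> 'cV[R]_d) :
  (forall i, measurable_fun setT (fun t => f t i ord0)) ->
  (forall i, measurable_fun setT (fun t => g t i ord0)) ->
  measurable_fun setT (fun t => sqdist (f t) (g t)).
Proof.
move=> mf mg; apply: measurable_sum => i; apply: measurable_funX.
exact: measurable_funB.
Qed.

Lemma sqrisk_likelihood mu delta : coord_measurable delta ->
  (sqrisk mu delta =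
   \int[P 0]_xi (sqdist (delta xi) mu * likelihood S mu xi)%:E)%E.
Proof.
move=> mdelta; rewrite /sqrisk integral_likelihood//.
- by apply/measurable_EFinP; exact: measurable_sqdist.
- by move=> xi; rewrite lee_fin sqdist_ge0.
Qed.

(** The constant [k] depends on [mu] but not on the rule, so comparing risks
    amounts to comparing [sqrisk], whose integrand is polynomial in [mu]. *)
Lemma sqrisk_risk mu : (forall i, l i <= u i) -> exists k : R,
  forall delta, coord_measurable delta -> (forall xi, box l u (delta xi)) ->
  (sqrisk mu delta = 2%:E * risk (box l u) S_spd mu delta + k%:E)%E.
Proof.
move=> lu; have [k k0 kP] := loss_sqdist mu lu; exists k => delta mdelta deltaX.
pose L xi := loss (box l u) mu (delta xi).
have L0 xi : (0 <= (L xi)%:E)%E by rewrite lee_fin; have [] := kP _ (deltaX xi).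
have mL : measurable_fun setT (fun xi => (L xi)%:E).
  apply/measurable_EFinP; rewrite (_ : L = fun xi =>
      2^-1 * (sqdist (delta xi) mu - k)); last first.
    apply/funext => xi; have [_ ->] := kP _ (deltaX xi).
    by rewrite addrK mulKf.
  apply: measurable_funM => //; apply: measurable_funB => //.
  exact: measurable_sqdist.
rewrite /risk unlock -ge0_integralZl; last 4 first.
- by [].
- exact: mL.
- by move=> xi _; exact: L0.
- by rewrite lee_fin.
rewrite -[in RHS](integral_cst_probability (P mu) k%:E) -ge0_integralD//.
- by apply: eq_integral => xi _; have [_ ->] := kP _ (deltaX xi).
- by move=> xi _; apply: mule_ge0; [rewrite lee_fin|exact: L0].
- exact: measurable_funeM.
Qed.

Hypothesis d_le4 : (d <= 4)%N.
Variables (delta delta' : n.-tuple 'cV[R]_d -> 'cV[R]_d).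
Hypothesis deltaE : forall xi i,
  delta xi i ord0 = clip (l i) (u i) (sample_mean xi i ord0).
Hypothesis mdelta' : coord_measurable delta'.
Hypothesis delta'X : forall xi, box l u (delta' xi).
Hypothesis le_sqrisk : forall mu, (sqrisk mu delta' <= sqrisk mu delta)%E.

Let mdelta : coord_measurable delta.
Proof.
move=> i; under eq_fun do rewrite deltaE.
by apply: measurable_clip; exact: measurable_sample_mean.
Qed.

(* The factor [2] makes [(1 - b^-1) * M] at least the absolute value of each
   bound of the box, as [b >= 2]. *)
Let M : R := 2 * \sum_i (`|l i| + `|u i|).

Let lM_uM i : 2 * `|l i| <= M /\ 2 * `|u i| <= M.
Proof.
rewrite /M (bigD1 i)//=; set s := \sum_(j | _) _.
have s0 : 0 <= s by apply: sumr_ge0 => j _; exact: addr_ge0.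
by have := normr_ge0 (l i); have := normr_ge0 (u i); split; lra.
Qed.

Section fixed_prior.
Variables (k : nat) (k_gt0 : (0 < k)%N).
Let b : R := 1 + n%:R * k%:R ^+ 2.
Local Notation W := (@marginal R d n S k%:R).

Let joint (e : n.-tuple 'cV[R]_d -> 'cV[R]_d)
    (w : 'cV[R]_d * n.-tuple 'cV[R]_d) : \bar R :=
  (sqdist (e w.2) (k%:R *: w.1) * likelihood S (k%:R *: w.1) w.2)%:E.

Let joint_ge0 e w : (0 <= joint e w)%E.
Proof. by rewrite lee_fin mulr_ge0 ?sqdist_ge0// expR_ge0. Qed.

Let measurable_joint e : coord_measurable e -> measurable_fun setT (joint e).
Proof.
move=> me; have mz i : measurable_fun setT
    (fun w : 'cV[R]_d * n.-tuple 'cV[R]_d => (k%:R *: w.1) i ord0).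
  under eq_fun do rewrite mxE; apply: measurable_funM => //.
  exact: (measurableT_comp (@measurable_coord R d i)).
apply/measurable_EFinP/measurable_funM; last exact: measurable_likelihood.
by apply: measurable_sqdist => // i; exact: (measurableT_comp (me i)).
Qed.

Let bayes_post e xi : \bar R := (\int[N]_z joint e (z, xi))%E.

Let bayes_post_ge0 e xi : (0 <= bayes_post e xi)%E.
Proof. by apply: integral_ge0 => z _; exact: joint_ge0. Qed.

Let measurable_bayes_post e : coord_measurable e ->
  measurable_fun setT (bayes_post e).
Proof.
move=> me.
exact: (measurable_fun_fubini_tonelli_G _ (measurable_joint me) (joint_ge0 e)).
Qed.

Let bayesE e : coord_measurable e ->
  (\int[P 0]_xi bayes_post e xi = \int[N]_z sqrisk (k%:R *: z) e)%E.
Proof.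
move=> me; rewrite -(fubini_tonelli _ (measurable_joint me) (joint_ge0 e)).
by apply: eq_integral => z _; rewrite sqrisk_likelihood.
Qed.

Let measurable_sqrisk e : coord_measurable e ->
  measurable_fun setT (fun z => sqrisk (k%:R *: z) e).
Proof.
move=> me; under eq_fun do rewrite sqrisk_likelihood//.
exact: (measurable_fun_fubini_tonelli_F _ (measurable_joint me) (joint_ge0 e)).
Qed.

Let bayes_delta_fin : (\int[P 0]_xi bayes_post delta xi < +oo)%E.
Proof.
have mz i : measurable_fun setT (fun z : 'cV[R]_d => ((0 - k%:R * z i ord0) ^+ 2)%:E).
  apply/measurable_EFinP/measurable_funX/measurable_funB => //.
  by apply: measurable_funM => //; exact: measurable_coord.
have z0 i (z : 'cV[R]_d) : (0 <= ((0 - k%:R * z i ord0) ^+ 2)%:E)%E.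
  by rewrite lee_fin sqr_ge0.
have mF := measurable_sqrisk mdelta.
have delta_le xi i : delta xi i ord0 ^+ 2 <= M ^+ 2.
  have /andP[lx xu] := delta'X xi i; have [lM uM] := lM_uM i.
  have lu : l i <= u i by exact: le_trans xu.
  have : l i <= delta xi i ord0 <= u i.
    by rewrite deltaE /clip le_max lexx /= ge_max lu ge_min lexx orbT.
  move=> /andP[{}lx {}xu]; have := lerNnormlW (lexx `|l i|).
  by have := ler_norm (u i); have := normr_ge0 (l i); nra.
pose c := \sum_(i < d) 2 * M ^+ 2.
have c0 : 0 <= c by apply: sumr_ge0 => i _; rewrite mulr_ge0// sqr_ge0.
rewrite bayesE//; apply: (@le_lt_trans _ _ (\int[N]_z (c%:E +
    2%:E * \sum_i ((0 - k%:R * z i ord0) ^+ 2)%:E))%E).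
  apply: ge0_le_integral => //.
  - by move=> z _; apply: integral_ge0 => xi _; rewrite lee_fin sqdist_ge0.
  - apply: emeasurable_funD => //; apply: measurable_funeM.
    exact: emeasurable_sum.
  - move=> z _; rewrite sumEFin -EFinM -EFinD.
    rewrite -[leRHS](integral_cst_probability (P (k%:R *: z))).
    apply: ge0_le_integral => //.
    + by move=> xi _; rewrite lee_fin sqdist_ge0.
    + by apply/measurable_EFinP; exact: measurable_sqdist.
    + move=> xi _; rewrite lee_fin /c mulr_sumr -big_split /=.
      apply: ler_sum => i _; rewrite mxE.
      have := delta_le xi i; set x := delta _ _ _; set y := _ * z _ _.
      by have := sqr_ge0 (x + y); nra.
rewrite ge0_integralD//; last 2 first.
- by move=> z _; rewrite mule_ge0// sume_ge0.
- by apply: measurable_funeM; exact: emeasurable_sum.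
rewrite [X in (X + _)%E](integral_cst_probability N).
rewrite ge0_integralZl//; last 2 first.
- exact: emeasurable_sum.
- by move=> z _; exact: sume_ge0.
rewrite ge0_integral_sum//.
pose s2 i := s2val (cid2 (gaussian_second_moment S_spd 0 i)).
under eq_bigr => i _ do
  rewrite (s2valP' (cid2 (gaussian_second_moment S_spd 0 i))) -/(s2 i).
by rewrite sumEFin -EFinM -EFinD ltry.
Qed.

Let b2 : 2 <= b.
Proof.
rewrite /b -natrX -natrM -natr1 addrC lerD2l ler1n muln_gt0 n_gt0.
by rewrite expn_gt0 k_gt0.
Qed.

Let b0 : 0 < b. Proof. exact: lt_le_trans b2. Qed.

Let W_ge xi : b^-1 ^+ 2 <= W xi.
Proof.
apply: le_trans (marginal_ge S_spd k%:R xi); rewrite -/b.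
rewrite exprVn lef_pV2 ?posrE ?exprn_gt0// ?sqrtr_gt0 ?exprn_gt0//.
rewrite -[leRHS]ger0_norm ?exprn_ge0 ?(ltW b0)// -sqrtr_sqr -exprM.
rewrite ler_wsqrtr// ler_weXn2l//.
by apply: le_trans b2; rewrite ler1n.
Qed.

Let bayes_postE xi : exists2 v, 0 <= v & forall e,
  (bayes_post e xi = (W xi * (v +
    \sum_i (e xi i ord0 - (1 - b^-1) * sample_mean xi i ord0) ^+ 2))%:E)%E.
Proof.
have [v v0 vP] := posterior_risk S_spd k%:R xi; exists v => // e.
apply: etrans (vP (e xi)); apply: eq_integral => z _; rewrite /joint /=.
by congr (_ * _)%:E; apply: eq_bigr => i _; rewrite mxE.
Qed.

Let bayes_post_gap xi :
  (bayes_post delta xi + (2^-1 * (W xi * sqdist (delta' xi) (delta xi)))%:E <=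
   bayes_post delta' xi +
   (2 * (b^-1 ^+ 2 * M ^+ 2) * \sum_i (\1_(strip i M) xi * W xi))%:E)%E.
Proof.
have [v v0 vP] := bayes_postE xi; rewrite !vP -!EFinD lee_fin.
have W0 : 0 <= W xi by exact: marginal_ge0.
rewrite -mulr_suml [X in _ <= _ + X]mulrA [X in _ <= _ + X]mulrC.
rewrite mulrCA -!mulrDr ler_wpM2l// -!addrA lerD2l /sqdist !mulr_sumr.
rewrite -!big_split /=; apply: ler_sum => i _; rewrite deltaE.
have -> : \1_(strip i M) xi = (`|sample_mean xi i ord0| <= M)%R%:R :> R.
  by rewrite indicE [X in nat_of_bool X]asboolb.
apply: clip_shrink; [|exact: delta'X|exact: (lM_uM i).1|exact: (lM_uM i).2].
by rewrite invr_gt0 b0 lef_pV2 ?posrE.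
Qed.

(** Blyth's inequality.  The possible advantage of [delta'] is of order [b ^- 2] and
    confined to the strips, whereas its distance to [delta] is paid for with the
    weight [W], which is at least [b ^- 2] because [d <= 4]. *)
Lemma integral_sqdist_le :
  (\int[P 0]_xi (sqdist (delta' xi) (delta xi))%:E <=
   (4 * M ^+ 2)%:E * \sum_i \int[P 0]_xi (\1_(strip i M) xi * W xi)%:E)%E.
Proof.
have m1W i : measurable_fun setT (fun xi => (\1_(strip i M) xi * W xi)%:E).
  apply/measurable_EFinP/measurable_funM; last exact: measurable_marginal.
  by apply: measurable_indic; exact: measurable_strip.
have W0 xi : 0 <= W xi by exact: marginal_ge0.
pose gap xi : \bar R := (2^-1 * (W xi * sqdist (delta' xi) (delta xi)))%:E.
pose bad xi : \bar R :=
  (2 * (b^-1 ^+ 2 * M ^+ 2) * \sum_i (\1_(strip i M) xi * W xi))%:E.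
have mD : measurable_fun setT (fun xi => sqdist (delta' xi) (delta xi)).
  exact: measurable_sqdist.
have mgap : measurable_fun setT gap.
  apply/measurable_EFinP; apply: measurable_funM => //.
  by apply: measurable_funM => //; exact: measurable_marginal.
have mbad : measurable_fun setT bad.
  apply/measurable_EFinP; apply: measurable_funM => //.
  by apply: measurable_sum => i; apply/measurable_EFinP; exact: m1W.
have gap0 xi : (0 <= gap xi)%E.
  by rewrite lee_fin !mulr_ge0// sqdist_ge0.
have bad0 xi : (0 <= bad xi)%E.
  rewrite lee_fin mulr_ge0//; first by rewrite mulr_ge0// mulr_ge0// sqr_ge0.
  by apply: sumr_ge0 => i _; rewrite mulr_ge0.
have gap_bad : (\int[P 0]_xi gap xi <= \int[P 0]_xi bad xi)%E.
  have Jfin : (\int[P 0]_xi bayes_post delta xi)%E \is a fin_num.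
    by rewrite ge0_fin_numE ?bayes_delta_fin// integral_ge0.
  have J'J : (\int[P 0]_xi bayes_post delta' xi <=
      \int[P 0]_xi bayes_post delta xi)%E.
    rewrite !bayesE//; apply: ge0_le_integral => //.
    - by move=> z _; apply: integral_ge0 => xi _; rewrite lee_fin sqdist_ge0.
    - exact: measurable_sqrisk.
    - exact: measurable_sqrisk.
  rewrite -(leeD2lE _ _ Jfin); apply: (@le_trans _ _
    (\int[P 0]_xi bayes_post delta' xi + \int[P 0]_xi bad xi)%E).
    rewrite -!ge0_integralD//; try exact: measurable_bayes_post.
    apply: ge0_le_integral => //.
    - by move=> xi _; exact: adde_ge0.
    - by apply: emeasurable_funD => //; exact: measurable_bayes_post.
    - by apply: emeasurable_funD => //; exact: measurable_bayes_post.
  by rewrite leeD2r.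
have a0 : 0 < 2^-1 * b^-1 ^+ 2 by rewrite mulr_gt0// exprn_gt0// invr_gt0.
rewrite -(@lee_pmul2l _ (2^-1 * b^-1 ^+ 2)%:E)//.
apply: (@le_trans _ _ (\int[P 0]_xi gap xi)%E).
  rewrite -ge0_integralZl//; last 3 first.
  - exact/measurable_EFinP.
  - by move=> xi _; rewrite lee_fin sqdist_ge0.
  - by rewrite lee_fin ltW.
  apply: ge0_le_integral => //.
  - by move=> xi _; rewrite -EFinM lee_fin mulr_ge0 ?sqdist_ge0// ltW.
  - by apply: measurable_funeM; exact/measurable_EFinP.
  - move=> xi _; rewrite -EFinM lee_fin -mulrA ler_wpM2l//.
    by rewrite ler_wpM2r ?sqdist_ge0.
apply: (le_trans gap_bad); rewrite -ge0_integral_sum//; last first.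
  by move=> i xi _; rewrite lee_fin mulr_ge0.
rewrite muleA -EFinM -ge0_integralZl//; last 3 first.
- exact: emeasurable_sum.
- by move=> xi _; apply: sume_ge0 => i _; rewrite lee_fin mulr_ge0.
- by rewrite lee_fin mulr_ge0 ?(ltW a0)// mulr_ge0// sqr_ge0.
rewrite le_eqVlt; apply/orP; left; apply/eqP; apply: eq_integral => xi _.
by rewrite /bad sumEFin -EFinM; congr (_ * _)%:E; set a := b^-1; field.
Qed.

End fixed_prior.

Lemma integral_sqdist_eq0 :
  (\int[P 0]_xi (sqdist (delta' xi) (delta xi))%:E = 0)%E.
Proof.
apply/eqP; rewrite eq_le integral_ge0 ?andbT; last first.
  by move=> xi _; rewrite lee_fin sqdist_ge0.
pose s k := (\sum_i \int[P 0]_xi (\1_(strip i M) xi * marginal S k%:R xi)%:E)%E.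
have s0 : ((4 * M ^+ 2)%:E * s k @[k --> \oo] --> 0)%E.
  rewrite -[X in _ --> X](mule0 (4 * M ^+ 2)%:E); apply: cvgeZl => //.
  rewrite (_ : 0%E = \sum_(i < d) 0%E); last by rewrite big1.
  apply: cvg_nnesum => [i _|i _].
    apply: nearW => k; apply: integral_ge0 => xi _.
    by rewrite lee_fin mulr_ge0// marginal_ge0.
  exact: marginal_strip_cvg0.
rewrite -(cvg_lim _ s0)//; apply: lime_ge; first by apply/cvg_ex; exists 0%E.
by exists 1%N => // k k0; exact: integral_sqdist_le.
Qed.

End bayes_comparison.

(** * Admissibility *)

Lemma sqdist_eq0 (R : realType) d (x y : 'cV[R]_d) : sqdist x y = 0 -> x = y.
Proof.
move=> /eqP; rewrite psumr_eq0; last by move=> i _; exact: sqr_ge0.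
move=> /allP xy; apply/colP => i; apply/eqP.
by have := xy i; rewrite mem_index_enum sqrf_eq0 subr_eq0; apply.
Qed.

Theorem theorem1p2 (R : realType) (d n : nat) (hd : (1 <= d <= 4)%N)
    (hn : (1 <= n)%N) (l u : 'I_d -> R) (hlu : forall i, l i <= u i)
    (Sigma : 'M[R]_d) (hSigma : symposdef Sigma)
    (delta_SA : n.-tuple 'cV[R]_d -> 'cV[R]_d)
    (hSA : forall xi, argmin (box l u) (fun x => F x (sample_mean xi)) (delta_SA xi)) :
  admissible (box l u) hSigma delta_SA.
Proof.
move=> [delta [mdelta deltaX _] [le_risk [mu]]].
have /andP[_ d_le4] := hd.
have cm_delta : coord_measurable delta.
  by move=> i; exact: (measurableT_comp (@measurable_coord R d i) mdelta).
have SAX xi : box l u (delta_SA xi) by have [] := hSA xi.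
have SAE xi i := argmin_box i (hSA xi).
have cm_SA : coord_measurable delta_SA.
  move=> i; under eq_fun do rewrite SAE.
  by apply: measurable_clip; exact: measurable_sample_mean.
have le_sq nu : (sqrisk hSigma nu delta <= sqrisk hSigma nu delta_SA)%E.
  have [k kP] := sqrisk_risk n hSigma nu hlu; rewrite !kP//.
  by rewrite leeD2r// lee_pmul2l// le_risk.
have := integral_sqdist_eq0 hn d_le4 SAE cm_delta deltaX le_sq.
set D := fun xi => (sqdist (delta xi) (delta_SA xi))%:E => D0.
have mD : measurable_fun setT D.
  by apply/measurable_EFinP; exact: measurable_sqdist.
have aeD : ae_eq (sample_law n hSigma 0) setT D (cst 0%E).
  apply/ae_eq_integral_abs => //; rewrite -[RHS]D0.
  by apply: eq_integral => xi _; rewrite gee0_abs// lee_fin sqdist_ge0.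
have msq e : coord_measurable e -> measurable_fun setT (fun xi =>
    (sqdist (e xi) mu * likelihood Sigma mu xi)%:E).
  move=> me; apply/measurable_EFinP/measurable_funM.
    exact: measurable_sqdist.
  exact: measurable_likelihood.
have sqE : sqrisk hSigma mu delta = sqrisk hSigma mu delta_SA.
  rewrite !sqrisk_likelihood//; apply: ge0_ae_eq_integral => //.
  - exact: msq.
  - exact: msq.
  - by move=> xi _; rewrite lee_fin mulr_ge0 ?sqdist_ge0// expR_ge0.
  - by move=> xi _; rewrite lee_fin mulr_ge0 ?sqdist_ge0// expR_ge0.
  by apply: filterS aeD => xi + _ => /(_ I)[/sqdist_eq0 ->].
have [k kP] := sqrisk_risk n hSigma mu hlu.
move: sqE; rewrite !kP// => sqE lt_risk.
have : (2%:E * risk (box l u) hSigma mu delta + k%:E <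
        2%:E * risk (box l u) hSigma mu delta_SA + k%:E)%E.
  by rewrite lteD2rE// lte_pmul2l.
by rewrite sqE ltxx.
Qed.
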